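(* For any Banach spaces $X$, $Y$ (not necessarily separable) with $\mathrm{Sz}(X)\leq\omega$ and $\mathrm{Sz}(Y)\leq\omega$, the injective tensor product $X\hat{\otimes}_{\varepsilon}Y$ satisfies $$\mathsf{p}(X\hat{\otimes}_{\varepsilon}Y)=\max\{\mathsf{p}(X),\mathsf{p}(Y)\}.$$
   Context: For a Banach space $X$, $B_X$ denotes its unit ball. For a weak$^\ast$-compact set $K\subset X^\ast$ and $\varepsilon>0$, the $\varepsilon$-Szlenk derivation is $$\iota_\varepsilon K=\{x^\ast\in K:\ \mathrm{diam}(K\cap U)>\varepsilon\text{ for every }w^\ast\text{-open neighborhood }U\text{ of }x^\ast\},$$ with iterates $\iota^0_\varepsilon K=K$, $\iota_\varepsilon^{\alpha+1}K=\iota_\varepsilon(\iota_\varepsilon^\alpha K)$, and $\iota_\varepsilon^\alpha K=\bigcap_{\beta<\alpha}\iota_\varepsilon^\beta K$ for limit $\alpha$. $\mathrm{Sz}(X,\varepsilon)$ is the least ordinal $\alpha$ (if any) with $\iota_\varepsilon^\alpha B_{X^\ast}=\varnothing$, and $\mathrm{Sz}(X)=\sup_{\varepsilon>0}\mathrm{Sz}(X,\varepsilon)$. The condition $\mathrm{Sz}(X)\leq\omega$ is equivalent to $\mathrm{Sz}(X,\varepsilon)$ being finite for every $\varepsilon>0$. For $\mathrm{Sz}(X)\le\omega$, the function $\varepsilon\mapsto\mathrm{Sz}(X,\varepsilon)$ is submultiplicative on $(0,1)$, so the following finite limit, called the Szlenk power type of $X$, exists: $$\mathsf{p}(X)=\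lim_{\varepsilon\to0+}\frac{\log\mathrm{Sz}(X,\varepsilon)}{|\log\varepsilon|}.$$
   Formalization: X and Y are assumed nonzero: for X = {0} and Y = ℓ₂ the injective tensor product is {0}, whose power type is 0, whereas max{p(X), p(Y)} = 2, so the claim fails for the trivial space. *)

(* Defs.v *)
From HB Require Import structures.
From mathcomp Require Import all_boot all_order all_algebra.
From mathcomp Require Import complex.
From mathcomp Require Import all_classical all_reals all_analysis.

Set Implicit Arguments.
Unset Strict Implicit.
Unset Printing Implicit Defensive.

Import Order.TTheory GRing.Theory Num.Theory.
Import numFieldNormedType.Exports.

Local Open Scope classical_set_scope.
Local Open Scope ring_scope.

(* Banach spaces are taken over either of the two usual scalar fields. *)
Inductive scalar_kind := RealScalars | ComplexScalars.

Definition scalar_field (R : realType) (k : scalar_kind) : numFieldType :=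
  match k with
  | RealScalars => R
  | ComplexScalars => R[i]
  end.

Definition scalar_re (R : realType) (k : scalar_kind) : scalar_field R k -> R :=
  match k with
  | RealScalars => fun x => x
  | ComplexScalars => fun z => complex.Re z
  end.

(* In MathComp-Analysis the norm of a normed module over K takes its values
   in K; [rnorm] reads this (real) scalar as an element of R. *)
Definition rnorm (R : realType) (k : scalar_kind)
    (V : normedModType (scalar_field R k)) (v : V) : R :=
  scalar_re `|v|.

(* Ordinals are represented by well-founded trees: [olim f] denotes the supremum
   of the ordinals denoted by [f a], [a : A], so every ordinal is denoted
   by some tree (not by a unique one). Accordingly [ole] compares the denoted
   ordinals, and "least" below means least for [ole]. *)
Inductive ord : Type :=
  | ozero
  | osucc of ord
  | olim (A : Type) of (A -> ord).

Fixpoint ole (a : ord) : ord -> Prop :=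
  match a with
  | ozero => fun=> True
  | osucc a' =>
      (* [olt b] is a' < b *)
      fix olt (b : ord) : Prop :=
        match b with
        | ozero => False
        | osucc b' => ole a' b'
        | olim _ g => exists i, olt (g i)
        end
  | olim _ f => fun b => forall i, ole (f i) b
  end.

Fixpoint ord_of_nat (n : nat) : ord :=
  if n is n'.+1 then osucc (ord_of_nat n') else ozero.

Definition omega : ord := olim ord_of_nat.

Section Szlenk.
Variables (R : realType) (k : scalar_kind).
Local Notation K := (scalar_field R k).

Section Dual.
Variable X : normedModType K.

Definition dual_space : set (X -> K^o) := [set f | linear f /\ continuous f].

Definition dual_norm (f : X -> K^o) : \bar R :=
  ereal_sup [set (rnorm (f x))%:E | x in [set x : X | rnorm x <= 1]].

Definition dual_ball : set (X -> K^o) :=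
  [set f | dual_space f /\ (dual_norm f <= 1)%E].

Definition diam (S : set (X -> K^o)) : \bar R :=
  ereal_sup [set dual_norm (f \- g) | f in S & g in S].

(* The weak* topology is the one induced on the dual by the topology of
   pointwise convergence on all functions X -> K. For S included in the
   dual, S `&` U runs over the same sets whether U is weak*-open in the dual
   or open in {ptws X -> K^o}. *)
Definition szlenk_deriv (e : R) (S : set (X -> K^o)) : set (X -> K^o) :=
  [set f | S f /\ forall U : set {ptws X -> K^o},
     open U -> U f -> (e%:E < diam (S `&` U))%E].

(* As the iterates decrease, the intersection over the [f i] is the iterate
   at their supremum; S itself only matters when the supremum is 0 because
   the index type is empty. *)
Fixpoint szlenk_iter (e : R) (a : ord) (S : set (X -> K^o)) :
    set (X -> K^o) :=
  match a with
  | ozero => S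
  | osucc a' => szlenk_deriv e (szlenk_iter e a' S)
  | olim _ f => S `&` \bigcap_i szlenk_iter e (f i) S
  end.

(* Sz(X, e) exists and is equal to a *)
Definition is_szlenk_eps (e : R) (a : ord) : Prop :=
  szlenk_iter e a dual_ball = set0 /\
  forall b, szlenk_iter e b dual_ball = set0 -> ole a b.

(* Sz(X) = sup_(e > 0) Sz(X, e) exists and is at most a *)
Definition szlenk_le (a : ord) : Prop :=
  forall e : R, 0 < e -> exists2 b, is_szlenk_eps e b & ole b a.

(* Sz(X, e) as a natural number; meaningful only when it is finite *)
Definition szlenk_nat (e : R) : nat :=
  xget 0%N [set n | is_szlenk_eps e (ord_of_nat n)].

Definition power_type : R :=
  lim ((fun e : R => ln (szlenk_nat e)%:R / `|ln e|) @ 0^'+).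

End Dual.

(* (T, tau) is the completion of the algebraic tensor product of X and Y for
   the injective norm, the pure tensor of x and y being sent to [tau x y].
   This determines (T, tau) up to isometric isomorphism: by the norm formula
   the linear map from the algebraic tensor product to T induced by tau is
   isometric for the injective norm, hence one-to-one. *)
Record is_injective_tensor (X Y T : completeNormedModType K)
    (tau : X -> Y -> T) : Prop := {
  inj_tensor_linear_l : forall y, linear (fun x => tau x y);
  inj_tensor_linear_r : forall x, linear (tau x);
  inj_tensor_norm : forall (n : nat) (x : 'I_n -> X) (y : 'I_n -> Y),
    (rnorm (\sum_(i < n) tau (x i) (y i)))%:E =
    ereal_sup [set (rnorm (\sum_(i < n) f (x i) * g (y i) : K^o))%:E
              | f in @dual_ball X & g in @dual_ball Y];
  inj_tensor_dense :
    dense [set t : T | exists (n : nat) (x : 'I_n -> X) (y : 'I_n -> Y),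
             t = \sum_(i < n) tau (x i) (y i)]
}.

End Szlenk.

(* Main.v *)
Require Import Defs.
From mathcomp Require Import all_boot all_order all_algebra.
From mathcomp Require Import complex.
From mathcomp Require Import all_classical all_reals all_analysis.
From mathcomp Require Import ring lra.

(** Fix a level e. The derived sets of the dual ball of T only see the functionals f (x) g,
    with f and g in the dual balls of X and Y, since these norm T. Pick phi in the n-th derived
    set of the dual ball of T and move n times to a nearby functional at distance more than
    e/2, witnessed by an element t of T that can be taken weakly null; choosing phases, the sum
    of the n witnesses has norm at least c n e, so some f (x) g is at least c n e on it.
    Taking ultrafilter limits of the (f, g) backwards along the tree of choices, the witness of
    each step contributes at most a + b, where a and b are the distances from f and g to their
    weak* limits. A jump of f by more than s when passing to its weak* limit raises by one the
    number of s-derivations that f survives, so the sum of all jumps a is controlled by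
    sum_j 2^-j (Sz(X, 2^-j) - 1), and similarly for b. Hence
      e (Sz(T, e) - 1) <= C sum_{2^-j >= c e} 2^-j (Sz(X, 2^-j) + Sz(Y, 2^-j) - 2),
    which gives p(T) <= max(p(X), p(Y)) when this maximum is at least 1. Otherwise the sum
    vanishes: if Sz(X, s) > 1 for some s then Sz(X, e) >= c/e for small e, so p(X) >= 1.
    Conversely f |-> f (x) g embeds the dual ball of X into that of T for a fixed nonzero g,
    given by the Hahn-Banach theorem. *)

Set Implicit Arguments.
Unset Strict Implicit.
Unset Printing Implicit Defensive.

Import Order.TTheory GRing.Theory Num.Theory.
Import numFieldNormedType.Exports.

Local Open Scope classical_set_scope.
Local Open Scope ring_scope.

(** * The real and complex scalar fields *)

Section Scalars.
Variables (R : realType) (k : scalar_kind).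
Local Notation K := (scalar_field R k).

Definition emb : R -> K :=
  match k return R -> scalar_field R k with
  | RealScalars => fun x => x
  | ComplexScalars => fun x => real_complex R x
  end.

Lemma embD x y : emb (x + y) = emb x + emb y.
Proof. by rewrite /emb; case: k => //=; rewrite rmorphD. Qed.

Lemma embM x y : emb (x * y) = emb x * emb y.
Proof. by rewrite /emb; case: k => //=; rewrite rmorphM. Qed.

Lemma emb1 : emb 1 = 1.
Proof. by rewrite /emb; case: k. Qed.

Lemma emb0 : emb 0 = 0.
Proof. by rewrite /emb; case: k. Qed.

Lemma embK x : scalar_re (emb x) = x.
Proof. by rewrite /emb; case: k. Qed.

Lemma ler_emb x y : (emb x <= emb y) = (x <= y).
Proof. by rewrite /emb; case: k => //=; rewrite lecR. Qed.

Lemma emb_ge0 (z : K) : 0 <= z -> emb (scalar_re z) = z.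
Proof.
rewrite /emb; move: z; case: k => //= z z0.
by rewrite RRe_real // ger0_real.
Qed.

Section Norm.
Variable V : normedModType K.
Implicit Types v w : V.

Lemma emb_rnorm v : emb (rnorm v) = `|v|.
Proof. by rewrite emb_ge0. Qed.

Lemma rnorm_ge0 v : 0 <= rnorm v.
Proof. by rewrite -ler_emb emb0 emb_rnorm. Qed.

Lemma rnormD v w : rnorm (v + w) <= rnorm v + rnorm w.
Proof. by rewrite -ler_emb embD !emb_rnorm ler_normD. Qed.

Lemma rnormN v : rnorm (- v) = rnorm v.
Proof. by rewrite /rnorm normrN. Qed.

Lemma rnorm0 : rnorm (0 : V) = 0.
Proof. by rewrite /rnorm normr0 -emb0 embK. Qed.

Lemma rnorm_eq0 v : rnorm v = 0 -> v = 0.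
Proof. by move=> v0; apply/normr0_eq0; rewrite -emb_rnorm v0 emb0. Qed.

Lemma rnorm_gt0 v : v != 0 -> 0 < rnorm v.
Proof.
by move=> v0; rewrite lt_neqAle rnorm_ge0 andbT eq_sym; apply: contra_neq v0 => /rnorm_eq0.
Qed.

Lemma rnormB v w : rnorm (v - w) = rnorm (w - v).
Proof. by rewrite -rnormN opprB. Qed.

Lemma rnorm_triangle u v w : rnorm (v - w) <= rnorm (v - u) + rnorm (u - w).
Proof. by apply: le_trans (rnormD _ _); rewrite addrA subrK. Qed.

Lemma ler_rnormB v w : rnorm v - rnorm w <= rnorm (v - w).
Proof. by rewrite lerBlDr -{1}(subrK w v) rnormD. Qed.

End Norm.

Definition nm (z : K) : R := rnorm (z : K^o).

Lemma rnormZ (V : normedModType K) (a : K) (v : V) : rnorm (a *: v) = nm a * rnorm v.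
Proof.
by rewrite /nm -[LHS]embK -[RHS]embK emb_rnorm normrZ embM (emb_rnorm v) (emb_rnorm (a : K^o)).
Qed.

Lemma nmM a b : nm (a * b) = nm a * nm b.
Proof. exact: (rnormZ a (b : K^o)). Qed.

Lemma nm_emb x : nm (emb x) = `|x|.
Proof.
rewrite /nm /rnorm /emb; case: k => //=.
by rewrite -[LHS]/(complex.Re `|real_complex R x : R[i]|) normc_def /= expr0n /= addr0 sqrtr_sqr.
Qed.

Lemma nm1 : nm 1 = 1.
Proof. by rewrite -emb1 nm_emb normr1. Qed.

Lemma nm0 : nm 0 = 0.
Proof. exact: (@rnorm0 K^o). Qed.

Lemma nm_ge0 z : 0 <= nm z. Proof. exact: rnorm_ge0. Qed.
Lemma nmD a b : nm (a + b) <= nm a + nm b. Proof. exact: (@rnormD K^o). Qed.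
Lemma nmN a : nm (- a) = nm a. Proof. exact: (@rnormN K^o). Qed.
Lemma nmB a b : nm (a - b) = nm (b - a). Proof. exact: (@rnormB K^o). Qed.
Lemma nm_triangle c a b : nm (a - b) <= nm (a - c) + nm (c - b).
Proof. exact: (@rnorm_triangle K^o). Qed.
Lemma ler_nmB a b : nm a - nm b <= nm (a - b).
Proof. exact: (@ler_rnormB K^o). Qed.
Lemma nm_eq0 z : nm z = 0 -> z = 0.
Proof. exact: (@rnorm_eq0 K^o). Qed.

Lemma nmV z : nm z^-1 = (nm z)^-1.
Proof.
have [->|z0] := eqVneq z 0; first by rewrite invr0 nm0 invr0.
have nz : nm z != 0 by apply: contra_neq z0 => /nm_eq0.
by apply: (mulIf nz); rewrite -nmM !mulVf // nm1.
Qed.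

Lemma emb_nm_mul (z : K) : exists2 u : K, nm u = 1 & u * z = emb (nm z).
Proof.
have [->|z0] := eqVneq z 0; first by exists 1; rewrite ?nm1 // mulr0 nm0 emb0.
have nz : nm z != 0 by apply: contra_neq z0 => /nm_eq0.
exists (emb (nm z) / z); last by rewrite divfK.
by rewrite nmM nm_emb nmV ger0_norm ?nm_ge0// divff.
Qed.

(** Phases replace signs: once both numbers are rotated onto the nonnegative reals their moduli add,
    so a new witness can be added without cancellation. *)
Lemma nm_align (a b : K) : exists2 u : K, nm u = 1 & nm (a + u * b) = nm a + nm b.
Proof.
have [u u1 ua] := emb_nm_mul a; have [v v1 vb] := emb_nm_mul b.
have u0 : u != 0 by apply/eqP => u0; move: u1; rewrite u0 nm0 => /esym/eqP; rewrite oner_eq0.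
exists (u^-1 * v); first by rewrite nmM nmV u1 v1 invr1 mulr1.
rewrite -[LHS]mul1r -u1 -nmM mulrDr ua !mulrA divff // mul1r vb -embD nm_emb.
by rewrite ger0_norm // addr_ge0 ?nm_ge0.
Qed.

(** Balls have radii in [K]; a positive element of [K] is real even over the complex field, so radii
    may be taken in [R]. *)
Lemma nbhs_rnormP (V : normedModType K) (v : V) (A : set V) :
  nbhs v A <-> exists2 e : R, 0 < e & forall w, rnorm (w - v) < e -> A w.
Proof.
split=> [/nbhs_normP[e e0 eA]|[e e0 eA]].
  have ee : emb (scalar_re e) = e by rewrite emb_ge0 // ltW.
  exists (scalar_re e).
    by rewrite lt_neqAle -ler_emb emb0 ee (ltW e0) andbT; apply: contraTN e0 => /eqP s0;
       rewrite -ee -s0 emb0 ltxx.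
  move=> w we; apply: eA; rewrite /= -emb_rnorm -ee.
  by rewrite lt_neqAle ler_emb rnormB (ltW we) andbT;
    apply: contraTN we => /eqP/(congr1 (@scalar_re R k));
    rewrite !embK => ->; rewrite ltxx.
apply/nbhs_normP; exists (emb e) => /=.
  by rewrite lt_neqAle -emb0 ler_emb (ltW e0) andbT;
    apply: contraTN e0 => /eqP/(congr1 (@scalar_re R k));
    rewrite !embK => ->; rewrite ltxx.
move=> w; rewrite /= -emb_rnorm => we; apply: eA; rewrite rnormB lt_neqAle -ler_emb (ltW we) andbT.
by apply: contraTN we => /eqP ->; rewrite ltxx.
Qed.

End Scalars.

(** * Weak* neighbourhoods and derived sets *)

(** The limit is the supremum of the x with x <= [h i] for U-almost all i; for an ultrafilter, a
    bound that fails has its negation hold almost everywhere. *)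
Lemma ultra_bounded_cvg_real (R : realType) (I : Type) (U : set_system I)
    (FU : UltraFilter U) (h : I -> R) (C : R) :
  U [set i | `|h i| <= C] ->
  exists z, forall d, 0 < d -> U [set i | `|h i - z| < d].
Proof.
move=> hC; pose A := [set x : R | U [set i | x <= h i]].
have A_ub : ubound A C.
  move=> x Ax; have [i [/= xi]] := filter_ex (filterI Ax hC).
  by rewrite ler_norml => /andP[_]; apply: le_trans.
have A0 : A (- C) by apply: filterS hC => i /=; rewrite ler_norml => /andP[].
have As : has_sup A by split; [exists (- C)|exists C].
exists (sup A) => d d0.
have [x Ax xd] := sup_adherent d0 As.
have nA : ~ A (sup A + d).
  by move=> /(sup_upper_bound As); rewrite gerDl leNgt d0.
have [//|UC] := in_ultra_setVsetC [set i | sup A + d <= h i] FU.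
apply: filterS (filterI Ax UC) => i [/= xi /negP]; rewrite -ltNge => hi.
by rewrite ltr_norml; apply/andP; split; lra.
Qed.

Section Duals.
Variables (R : realType) (k : scalar_kind).
Local Notation K := (scalar_field R k).

Lemma ultra_bounded_cvg (I : Type) (U : set_system I)
    (FU : UltraFilter U) (h : I -> K) (C : R) :
  U [set i | nm (h i) <= C] ->
  exists z, forall d, 0 < d -> U [set i | nm (h i - z) < d].
Proof.
rewrite /nm /rnorm; move: h; case: k => /= h hC.
  exact: ultra_bounded_cvg_real hC.
have nE (z : R[i]) : complex.Re (`|z : R[i]^o|) =
    Num.sqrt ((complex.Re z) ^+ 2 + (complex.Im z) ^+ 2).
  by rewrite -[LHS]/(complex.Re `|z : R[i]|) normc_def.
have nRe (z : R[i]) : `|complex.Re z| <= complex.Re (`|z : R[i]^o|).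
  by rewrite nE -sqrtr_sqr ler_wsqrtr // lerDl sqr_ge0.
have nIm (z : R[i]) : `|complex.Im z| <= complex.Re (`|z : R[i]^o|).
  by rewrite nE -sqrtr_sqr ler_wsqrtr // lerDr sqr_ge0.
have [|x xP] := @ultra_bounded_cvg_real R I U FU (fun i => complex.Re (h i)) C.
  by apply: filterS hC => i; apply: le_trans.
have [|y yP] := @ultra_bounded_cvg_real R I U FU (fun i => complex.Im (h i)) C.
  by apply: filterS hC => i; apply: le_trans.
have nle (z : R[i]) : complex.Re (`|z : R[i]^o|) <= `|complex.Re z| + `|complex.Im z|.
  rewrite nE -[leRHS]ger0_norm ?addr_ge0 // -sqrtr_sqr ler_wsqrtr //.
  rewrite sqrrD !real_normK ?num_real // lerD2r lerDl mulrn_wge0 // mulr_ge0 //.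
exists (x +i* y)%C => d d0; have d2 : 0 < d / 2 by lra.
apply: filterS (filterI (xP _ d2) (yP _ d2)) => i [/=].
move=> xa yb; apply: le_lt_trans (nle _) _.
by move: xa yb; case: (h i) => a b /= xa yb; lra.
Qed.

Lemma nm_lt_eq0 (z : K) : (forall d, 0 < d -> nm z < d) -> z = 0.
Proof.
move=> zd; apply: nm_eq0; apply/eqP; rewrite eq_le nm_ge0 andbT.
by apply/ler_addgt0Pr => d d0; rewrite add0r ltW // zd.
Qed.

Variable X : normedModType K.
Implicit Types (f g : X -> K^o) (S : set (X -> K^o)).

Section LinearFun.
Variable f : X -> K^o.
Hypothesis fl : linear f.

Lemma linear_fun0 : f 0 = 0.
Proof.
have := fl 1 0 0; rewrite !scale1r addr0 => /eqP.
by rewrite -subr_eq0 opprD addrA subrr sub0r oppr_eq0 => /eqP.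
Qed.

Lemma linear_funD x y : f (x + y) = f x + f y.
Proof. by have := fl 1 x y; rewrite !scale1r. Qed.

Lemma linear_funZ a x : f (a *: x) = a * f x.
Proof. by have := fl a x 0; rewrite !addr0 linear_fun0 addr0. Qed.

Lemma linear_funN x : f (- x) = - f x.
Proof. by rewrite -scaleN1r linear_funZ mulN1r. Qed.

Lemma linear_funB x y : f (x - y) = f x - f y.
Proof. by rewrite linear_funD linear_funN. Qed.

Lemma dual_norm_gtP (e : R) :
  (e%:E < dual_norm f)%E <-> exists2 x, rnorm x <= 1 & e < nm (f x).
Proof.
split=> [/ereal_sup_gt[_ [x /= x1 <-]]|[x x1 ex]].
  by rewrite lte_fin => ex; exists x.
apply: lt_le_trans (_ : ((nm (f x))%:E <= _)%E); first by rewrite lte_fin.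
by apply: ereal_sup_ubound; exists x.
Qed.

Lemma linear_bounded_on_ball (C : R) : (forall x, rnorm x <= 1 -> nm (f x) <= C) ->
  forall x, nm (f x) <= C * rnorm x.
Proof.
move=> fC x; have [->|x0] := eqVneq x 0.
  by rewrite linear_fun0 nm0 rnorm0 mulr0.
have rx := rnorm_gt0 x0.
have nr : nm (emb k (rnorm x)^-1) = (rnorm x)^-1.
  by rewrite nm_emb ger0_norm // invr_ge0 ltW.
have := fC (emb k (rnorm x)^-1 *: x).
rewrite rnormZ linear_funZ nmM nr mulVf ?gt_eqF // => /(_ (lexx _)).
by rewrite mulrC ler_pdivrMr.
Qed.

Lemma linear_bounded_continuous (C : R) : (forall x, nm (f x) <= C * rnorm x) ->
  continuous f.
Proof.
move=> fC x A /nbhs_rnormP[e e0 eA]; apply/nbhs_rnormP.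
exists (e / (`|C| + 1)); first by rewrite divr_gt0 // ltr_wpDl.
move=> y yx; apply: eA; rewrite -linear_funB.
apply: le_lt_trans (fC _) _.
apply: le_lt_trans (_ : (`|C| + 1) * rnorm (y - x) < e); last first.
  by rewrite mulrC -ltr_pdivlMr // ltr_wpDl.
by rewrite ler_wpM2r ?rnorm_ge0 // (le_trans (ler_norm _)) // lerDl.
Qed.

End LinearFun.

Lemma dual_ballP f : dual_ball f <-> linear f /\ forall x, nm (f x) <= rnorm x.
Proof.
split=> [[[fl _] f1]|[fl f1]].
  split=> // x; rewrite -[leRHS]mul1r; apply: (linear_bounded_on_ball fl) => {}x x1.
  rewrite -lee_fin; apply: le_trans f1; apply: ereal_sup_ubound.
  by exists x.
split; first split => //.
  by apply: (linear_bounded_continuous fl (C := 1)) => x; rewrite mul1r.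
by apply: ge_ereal_sup => _ [x /= x1 <-]; rewrite lee_fin (le_trans (f1 _)).
Qed.

(** Distance more than e in the dual norm, with an explicit witness in the unit ball; this avoids
    extended reals. *)
Definition gap (e : R) f g := exists2 x, rnorm x <= 1 & e < nm (f x - g x).

(** Basic weak* neighbourhoods of f: finitely many test points and one radius. *)
Definition near_on (xs : seq X) (d : R) f g := forall x, x \in xs -> nm (g x - f x) < d.

Lemma near_on_refl xs d f : 0 < d -> near_on xs d f f.
Proof. by move=> d0 x _; rewrite subrr nm0. Qed.

Lemma near_on_trans xs d1 d2 f g h :
  near_on xs d1 f g -> near_on xs d2 g h -> near_on xs (d1 + d2) f h.
Proof.
move=> fg gh x xxs; apply: le_lt_trans (nm_triangle (g x) _ _) _.
by rewrite addrC ltrD ?fg ?gh.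
Qed.

Lemma near_on_sub xs ys d d' f g : {subset xs <= ys} -> d <= d' ->
  near_on ys d f g -> near_on xs d' f g.
Proof. by move=> s dd fg x /s/fg/lt_le_trans; apply. Qed.

Lemma gap_diamP (e : R) S :
  (e%:E < diam S)%E <-> exists f g, [/\ S f, S g & gap e f g].
Proof.
split=> [/ereal_sup_gt[_ [f Sf [g Sg <-]]] /dual_norm_gtP [x x1 ex]|[f [g [Sf Sg fg]]]].
  by exists f, g; split => //; exists x.
apply: (@lt_le_trans _ _ (dual_norm (f \- g))); first exact/dual_norm_gtP.
by apply: ereal_sup_ubound; exists f => //; exists g.
Qed.

(** The filter generated by the sets [near_on] converges pointwise to f, hence contains every
    neighbourhood of f. Conversely each of the finitely many conditions is pulled back along a
    continuous evaluation. *)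
Lemma nbhs_ptwsP (f : {ptws X -> K^o}) (A : set {ptws X -> K^o}) :
  nbhs f A <-> exists xs d, 0 < d /\ forall g, near_on xs d f g -> A g.
Proof.
split=> [fA|[xs [d [d0 dA]]]].
  pose D := [set p : seq X * R | 0 < p.2].
  pose F : set_system (X -> K^o) := filter_from D (fun p => [set g | near_on p.1 p.2 f g]).
  have FF : Filter F.
    apply: filter_from_filter; first by exists ([::], 1); rewrite /D /=.
    move=> [xs d] [ys d'] /= d0 d'0; exists (xs ++ ys, Num.min d d') => /=.
      by rewrite /D /= lt_min d0 d'0.
    move=> g /= gn; split; apply: near_on_sub gn; rewrite ?ge_min ?lexx ?orbT//.
      by move=> x; rewrite mem_cat => ->.
    by move=> x; rewrite mem_cat => ->; rewrite orbT.
  have /(_ A fA) [[xs d] d0 dA] : {ptws, F --> f}.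
    apply/pointwise_cvgP => x B /nbhs_rnormP[e e0 eB].
    exists ([:: x], e) => //= g gn; apply: eB; apply: gn; exact: mem_head.
  by exists xs, d; split.
have cv (x : X) : (fun g : {ptws X -> K^o} => g x) @ (nbhs f) --> f x.
  by move: x; apply/(@pointwise_cvgP X K^o (nbhs f) f).
have : nbhs f [set g | near_on xs d f g].
  elim: {dA} xs => [|x xs ih].
    by apply: filterS (@filterT _ (nbhs f) _) => g _ x; rewrite in_nil.
  have : nbhs f [set g | nm (g x - f x) < d].
    have fx : nbhs (f x : K^o) [set z : K^o | nm (z - f x) < d].
      by apply/nbhs_rnormP; exists d.
    exact: (cv x _ fx).
  move=> h; have hi := @filterI _ (nbhs f) (@nbhs_filter {ptws X -> K^o} f) _ _ h ih.
  apply: (@filterS _ (nbhs f) (@nbhs_filter {ptws X -> K^o} f) _ _ _ hi) => g [/= gx gxs] y.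
  by rewrite inE => /orP[/eqP->//|/gxs].
exact: (@filterS _ (nbhs f) (@nbhs_filter {ptws X -> K^o} f)).
Qed.

Lemma szlenk_derivP (e : R) S f :
  szlenk_deriv e S f <-> S f /\ forall xs d, 0 < d ->
    exists f1 f2, [/\ S f1, S f2, near_on xs d f f1, near_on xs d f f2 & gap e f1 f2].
Proof.
split=> [[Sf fU]|[Sf fn]]; split=> //.
  move=> xs d d0.
  have fn : nbhs (f : {ptws X -> K^o}) [set g | near_on xs d f g].
    by apply/nbhs_ptwsP; exists xs, d; split.
  rewrite nbhsE in fn; case: fn => U [oU Uf] Un.
  have /gap_diamP[f1 [f2 [[S1 U1] [S2 U2] g12]]] := fU U oU Uf.
  by exists f1, f2; split => //; apply: Un.
move=> U oU Uf.
have /nbhs_ptwsP[xs [d [d0 dU]]] : nbhs (f : {ptws X -> K^o}) U by exact: open_nbhs_nbhs.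
have [f1 [f2 [S1 S2 n1 n2 g12]]] := fn xs d d0.
by apply/gap_diamP; exists f1, f2; split => //; split => //; apply: dU.
Qed.

(** Weak* closedness, phrased in the space of all functions so that a limit need not be known to be
    linear beforehand. *)
Definition wclosed S := forall f,
  (forall xs d, 0 < d -> exists2 g, S g & near_on xs d f g) -> S f.

Lemma szlenk_deriv_sub e S : szlenk_deriv e S `<=` S.
Proof. by move=> f []. Qed.

Lemma szlenk_deriv_wclosed e S : wclosed S -> wclosed (szlenk_deriv e S).
Proof.
move=> Sc f fn; apply/szlenk_derivP; split.
  apply: Sc => xs d /(fn xs)[g [Sg _] gn]; by exists g.
move=> xs d d0; have d2 : 0 < d / 2 by lra.
have [g /szlenk_derivP[Sg gn] fg] := fn xs _ d2.
have [f1 [f2 [S1 S2 n1 n2 g12]]] := gn xs _ d2.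
have dd : d = d / 2 + d / 2 by lra.
by exists f1, f2; split => //; rewrite dd; apply: near_on_trans fg _.
Qed.

Lemma szlenk_deriv_mono e S S' : S `<=` S' -> szlenk_deriv e S `<=` szlenk_deriv e S'.
Proof.
move=> SS f /szlenk_derivP[/SS Sf fn]; apply/szlenk_derivP; split => // xs d /(fn xs).
move=> [f1 [f2 [/SS S1 /SS S2 n1 n2 g12]]]; by exists f1, f2.
Qed.

Lemma gap_le e e' f g : e' <= e -> gap e f g -> gap e' f g.
Proof. by move=> ee [x x1 /(le_lt_trans ee)]; exists x. Qed.

Lemma szlenk_deriv_le e e' S : e' <= e -> szlenk_deriv e S `<=` szlenk_deriv e' S.
Proof.
move=> ee f /szlenk_derivP[Sf fn]; apply/szlenk_derivP; split => // xs d /(fn xs).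
move=> [f1 [f2 [S1 S2 n1 n2 /(gap_le ee) g12]]]; by exists f1, f2.
Qed.

Lemma dual_ball_wclosed : wclosed (@dual_ball R k X).
Proof.
move=> f fn; apply/dual_ballP; split.
  move=> a x y; apply/eqP; rewrite -subr_eq0; apply/eqP/nm_lt_eq0 => d d0.
  (* The defect of linearity at a, x, y is at most |a| + 2 times the approximation error at the
     three test points. *)
  have a2 : 0 < nm a + 2 by rewrite ltr_wpDl // nm_ge0.
  have [g /dual_ballP[gl _] gn] := fn [:: a *: x + y; x; y] _ (divr_gt0 d0 a2).
  have n1 := gn (a *: x + y); have n2 := gn x; have n3 := gn y.
  rewrite !inE !eqxx ?orbT in n1 n2 n3.
  have {}n1 := n1 isT; have {}n2 := n2 isT; have {}n3 := n3 isT.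
  have -> : f (a *: x + y) - (a *: f x + f y) =
     - (g (a *: x + y) - f (a *: x + y)) + (a * (g x - f x) + (g y - f y)).
    rewrite gl /GRing.scale /=; ring.
  apply: le_lt_trans (nmD _ _) _; rewrite nmN.
  apply: le_lt_trans (lerD (lexx _) (nmD _ _)) _; rewrite nmM.
  have -> : d = d / (nm a + 2) + (nm a * (d / (nm a + 2)) + d / (nm a + 2)).
    by field; rewrite gt_eqF.
  by rewrite ltr_leD // lerD // ?ler_wpM2l ?nm_ge0 // ltW.
move=> x; apply/ler_addgt0Pr => d /(fn [:: x])[g /dual_ballP[_ g1] /(_ x (mem_head _ _)) gx].
rewrite -[f x](subrK (g x)); apply: le_trans (nmD _ _) _.
by rewrite addrC lerD ?g1 // nmB ltW.
Qed.

Definition sz e n S := iter n (szlenk_deriv e) S.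

Lemma szS e n S : sz e n.+1 S = szlenk_deriv e (sz e n S). Proof. by []. Qed.

Lemma sz_wclosed e n S : wclosed S -> wclosed (sz e n S).
Proof. by move=> Sc; elim: n => // n ih; apply: szlenk_deriv_wclosed. Qed.

Lemma sz_leq e m n S : (m <= n)%N -> sz e n S `<=` sz e m S.
Proof.
elim: n => [|n ih]; first by rewrite leqn0 => /eqP->.
rewrite leq_eqVlt => /orP[/eqP->//|/ih]; apply: subset_trans; exact: szlenk_deriv_sub.
Qed.

Lemma sz_sub e n S : sz e n S `<=` S.
Proof. exact: (@sz_leq e 0). Qed.

Lemma sz_le e e' n S : e' <= e -> sz e n S `<=` sz e' n S.
Proof.
move=> ee; elim: n => // n ih; apply: subset_trans (szlenk_deriv_le ee).
exact: szlenk_deriv_mono.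
Qed.

Lemma sz_add e m n S : sz e (m + n) S = sz e m (sz e n S).
Proof. by rewrite /sz iterD. Qed.

Lemma sz_mono e n S S' : S `<=` S' -> sz e n S `<=` sz e n S'.
Proof. by move=> SS; elim: n => // n ih; apply: szlenk_deriv_mono. Qed.

(** Banach-Alaoglu in ultrafilter form: the limit is taken pointwise, the values at each x staying
    bounded by |x|. *)
Lemma ultra_ball_cvg (I : Type) (U : set_system I) (FU : UltraFilter U) (F : I -> X -> K^o) :
  U [set i | dual_ball (F i)] ->
  exists f, forall xs d, 0 < d -> U [set i | near_on xs d f (F i)].
Proof.
move=> UF.
have /choice[f fP] x : exists z, forall d, 0 < d -> U [set i | nm (F i x - z) < d].
  apply: ultra_bounded_cvg (_ : U [set i | _ <= rnorm x]).
  by apply: filterS UF => i /dual_ballP[_ /(_ x)].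
exists f => xs d d0; elim: xs => [|x xs ih].
  by apply: filterE => i y; rewrite in_nil.
apply: filterS (filterI (fP x d d0) ih) => i [/= ix ixs] y.
by rewrite inE => /orP[/eqP->//|/ixs].
Qed.

Lemma ultra_wclosed (I : Type) (U : set_system I) (FU : UltraFilter U) (F : I -> X -> K^o) S f :
  wclosed S -> (forall xs d, 0 < d -> U [set i | near_on xs d f (F i)]) ->
  U [set i | S (F i)] -> S f.
Proof.
move=> Sc Uf US; apply: Sc => xs d d0.
by have [i [/= Si ni]] := filter_ex (filterI US (Uf xs d d0)); exists (F i).
Qed.

(** Weak* compactness: pick a point in each n-th derived set; the limit along a free ultrafilter on
    n lies in all of them, as they are closed and decreasing. *)
Lemma szlenk_compact e : (forall n, sz e n (@dual_ball R k X) !=set0) ->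
  exists f, forall n, sz e n (@dual_ball R k X) f.
Proof.
move=> /choice[F FP].
have [U [FU UN]] := ultraFilterLemma (eventually_filter).
have [|f Uf] := ultra_ball_cvg FU (F := F).
  by apply: UN; exists 0%N => // n _ /=; apply: sz_sub (FP n).
exists f => n; apply: ultra_wclosed Uf _.
  by apply: sz_wclosed; exact: dual_ball_wclosed.
by apply: UN; exists n => // m /= nm; apply: sz_leq (FP m).
Qed.

End Duals.

(** * Finite Szlenk indices *)

Lemma ole_nat_refl n : ole (ord_of_nat n) (ord_of_nat n).
Proof. by elim: n. Qed.

Lemma ole_nat_leq m n : ole (ord_of_nat m) (ord_of_nat n) -> (m <= n)%N.
Proof. by elim: m n => // m ih [|n] //= /ih. Qed.

Lemma ole_nat_total m b : ~ ole (ord_of_nat m.+1) b -> ole b (ord_of_nat m).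
Proof.
elim: b m => [|b ih|A g ih] m //=.
  by case: m => [|m] mb; [exfalso; apply: mb; exact: I|exact: ih].
by move=> gm i; apply: ih => gi; apply: gm; exists i.
Qed.

Section FiniteSzlenk.
Variables (R : realType) (k : scalar_kind) (X : normedModType (scalar_field R k)).
Local Notation K := (scalar_field R k).
Local Notation B := (@dual_ball R k X).
Implicit Types (S : set (X -> K^o)) (e : R).

Lemma szlenk_iter_sub e a S : szlenk_iter e a S `<=` S.
Proof.
elim: a => [|a ih|A g _] //=.
exact: subset_trans (@szlenk_deriv_sub _ _ _ _ _) ih.
Qed.

(** By this the iterates depend only on the ordinal and not on the tree denoting it, so arbitrary
    trees can be compared with natural numbers. *)
Lemma szlenk_iter_ole e S a b : ole a b -> szlenk_iter e b S `<=` szlenk_iter e a S.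
Proof.
elim: a b => [|a iha|A f ihf] b.
- by move=> _; exact: szlenk_iter_sub.
- elim: b => [|b _|B' g ihg] //=; first by move/iha; exact: szlenk_deriv_mono.
  by move=> [i /ihg gi] f [_ /(_ i I)] /gi.
- move=> /= fb g gb; split; first exact: szlenk_iter_sub gb.
  by move=> i _; apply: ihf gb.
Qed.

Lemma szlenk_iter_nat e n S : szlenk_iter e (ord_of_nat n) S = sz e n S.
Proof. by elim: n => //= n ->. Qed.

Definition szlenk_fin e := exists n, sz e n B = set0.

(** If no finite iterate were empty, compactness would give a point in all of them, that is in the
    iterate of order omega, which Sz(X, e) <= omega makes empty. *)
Lemma szlenk_le_omega_fin : szlenk_le X omega -> forall e, 0 < e -> szlenk_fin e.
Proof.
move=> Xw e /Xw[b [b0 _] bw]; apply: contrapT => /forallNP nfin.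
have [|f fP] := @szlenk_compact _ _ X e.
  by move=> n; apply/set0P/eqP; exact: nfin.
have : szlenk_iter e b B f.
  apply: szlenk_iter_ole bw _ _; split; first exact: (fP 0%N).
  by move=> n _; rewrite szlenk_iter_nat.
by rewrite b0.
Qed.

(** Minimality among all ordinals reduces to minimality among naturals: an ordinal b that is not at
    least n + 1 is at most n, and then the n-th iterate would already be empty. *)
Lemma is_szlenk_eps_natP e n : is_szlenk_eps X e (ord_of_nat n) <->
  sz e n B = set0 /\ forall m, sz e m B = set0 -> (n <= m)%N.
Proof.
rewrite /is_szlenk_eps szlenk_iter_nat; split=> -[n0 nmin]; split=> //.
  by move=> m m0; apply/ole_nat_leq/nmin; rewrite szlenk_iter_nat.
move=> b b0; apply: contrapT.
case: n {n0} nmin => [|n] nmin; first by case.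
move=> /ole_nat_total/(@szlenk_iter_ole e B); rewrite b0 szlenk_iter_nat => nb.
suff /nmin : sz e n B = set0 by rewrite ltnn.
by rewrite -subset0.
Qed.

Lemma szlenk_natP e : szlenk_fin e ->
  sz e (szlenk_nat X e) B = set0 /\ forall m, sz e m B = set0 -> (szlenk_nat X e <= m)%N.
Proof.
move=> efin; apply/is_szlenk_eps_natP; rewrite /szlenk_nat.
have ex : exists n, `[< sz e n B = set0 >] by case: efin => n n0; exists n; apply/asboolP.
have [n /asboolP n0 nmin] := ex_minnP ex.
case: xgetP => [m _ //|/(_ n)[]]; apply/is_szlenk_eps_natP; split=> // m m0.
by apply: nmin; apply/asboolP.
Qed.

Lemma szlenk_fin_le_omega : (forall e, 0 < e -> szlenk_fin e) -> szlenk_le X omega.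
Proof.
move=> Xfin e /Xfin efin; exists (ord_of_nat (szlenk_nat X e)).
  exact/is_szlenk_eps_natP/szlenk_natP.
case: (szlenk_nat X e) => [//|n]; exists n.+1; exact: (ole_nat_refl n.+1).
Qed.

End FiniteSzlenk.

(** * Maps carrying derived sets into derived sets *)

Section Transport.
Variables (R : realType) (k : scalar_kind) (X Z : normedModType (scalar_field R k)).
Local Notation K := (scalar_field R k).

Definition wopen (U : set (X -> K^o)) := forall f, U f ->
  exists xs d, 0 < d /\ forall g, near_on xs d f g -> U g.

Definition wcontinuous_in (S : set (X -> K^o)) (Phi : (X -> K^o) -> (Z -> K^o)) :=
  forall f, S f -> forall zs d, 0 < d -> exists xs d', 0 < d' /\
    forall g, S g -> near_on xs d' f g -> near_on zs d (Phi f) (Phi g).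

Lemma near_on_wopen xs d f : wopen (near_on xs d f).
Proof.
move=> g fg; suff [r r0 rP] : exists2 r, 0 < r & forall x, x \in xs -> nm (g x - f x) + r <= d.
  exists xs, r; split=> // h gh x xxs; apply: le_lt_trans (nm_triangle (g x) _ _) _.
  by rewrite addrC; apply: lt_le_trans (rP _ xxs); rewrite ltrD2l gh.
elim: xs fg => [|x xs ih] fg; first by exists 1.
have [|r r0 rP] := ih; first by move=> y yxs; apply: fg; rewrite inE yxs orbT.
have gx := fg x (mem_head _ _).
exists (Num.min r (d - nm (g x - f x))); first by rewrite lt_min r0 subr_gt0.
move=> y; rewrite inE => /orP[/eqP->|/rP].
  by rewrite -lerBrDl ge_min lexx orbT.
by rewrite -!lerBrDl ge_min => ->.
Qed.

(** Close pairs with a gap are mapped to close pairs with a gap. The weak*-open set [U] localises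
    this: only the part of [S] inside [U] has to be sent into [S']. *)
Lemma szlenk_deriv_transport e e' S S' U Phi :
  wopen U -> wcontinuous_in S Phi ->
  (forall f, S f -> U f -> S' (Phi f)) ->
  (forall f g, S f -> S g -> U f -> U g -> gap e f g -> gap e' (Phi f) (Phi g)) ->
  forall f, szlenk_deriv e S f -> U f -> szlenk_deriv e' S' (Phi f).
Proof.
move=> Uo Phic PhiS Phig f /szlenk_derivP[Sf fn] Uf; apply/szlenk_derivP; split.
  exact: PhiS.
move=> zs d d0; have [xs [d1 [d10 Pn]]] := Phic f Sf zs d d0.
have [ys [d2 [d20 Un]]] := Uo f Uf.
have [|f1 [f2 [S1 S2 n1 n2 g12]]] := fn (xs ++ ys) (Num.min d1 d2).
  by rewrite lt_min d10 d20.
have sub g : near_on (xs ++ ys) (Num.min d1 d2) f g -> near_on xs d1 f g /\ U g.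
  move=> gn; split; [|apply: Un]; apply: near_on_sub gn; rewrite ?ge_min ?lexx ?orbT //.
    by move=> x; rewrite mem_cat => ->.
  by move=> x; rewrite mem_cat => ->; rewrite orbT.
have [n1x U1] := sub _ n1; have [n2x U2] := sub _ n2.
exists (Phi f1), (Phi f2); split; [exact: PhiS|exact: PhiS|exact: Pn|exact: Pn|exact: Phig].
Qed.

Lemma sz_transport e e' n S S' U Phi :
  wopen U -> wcontinuous_in S Phi ->
  (forall f, S f -> U f -> S' (Phi f)) ->
  (forall f g, S f -> S g -> U f -> U g -> gap e f g -> gap e' (Phi f) (Phi g)) ->
  forall f, sz e n S f -> U f -> sz e' n S' (Phi f).
Proof.
move=> Uo Phic PhiS Phig; elim: n => // n ih f Sf Uf; rewrite szS.
have sS g : sz e n S g -> S g by exact: sz_sub.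
apply: (szlenk_deriv_transport Uo _ ih _ Sf Uf).
  move=> {Sf Uf}f Sf zs d d0; have [xs [d' [d'0 nP]]] := Phic f (sS _ Sf) zs d d0.
  by exists xs, d'; split => // g /sS; exact: nP.
by move=> g h /sS Sg /sS Sh; exact: Phig.
Qed.

End Transport.

(** * Affine images of derived sets, submultiplicativity and linear growth *)

Section Affine.
Variables (R : realType) (k : scalar_kind) (X : normedModType (scalar_field R k)).
Local Notation K := (scalar_field R k).
Local Notation B := (@dual_ball R k X).
Implicit Types (S U : set (X -> K^o)) (e d c : R).

Definition affine_map (c : R) (h : X -> K^o) : (X -> K^o) -> (X -> K^o) :=
  fun f x => h x + emb k c * f x.

Lemma wcontinuous_affine c h S : wcontinuous_in S (affine_map c h).
Proof.
move=> f _ zs d d0; exists zs, (d / (`|c| + 1)); split.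
  by rewrite divr_gt0 // ltr_wpDl.
move=> g _ gn x /gn gx; rewrite /affine_map opprD addrACA subrr add0r -mulrBr.
rewrite nmM nm_emb; apply: le_lt_trans (_ : (`|c| + 1) * nm (g x - f x) < d).
  by rewrite ler_wpM2r ?nm_ge0 // lerDl.
by rewrite mulrC -ltr_pdivlMr // ltr_wpDl.
Qed.

Lemma gap_affine c h e f g : 0 < c -> gap e f g ->
  gap (c * e) (affine_map c h f) (affine_map c h g).
Proof.
move=> c0 [x x1 efg]; exists x => //.
rewrite /affine_map opprD addrACA subrr add0r -mulrBr nmM nm_emb gtr0_norm //.
by rewrite ltr_pM2l.
Qed.

Lemma sz_affine c h e n S S' U : 0 < c -> wopen U ->
  (forall f, S f -> U f -> S' (affine_map c h f)) ->
  forall f, sz e n S f -> U f -> sz (c * e) n S' (affine_map c h f).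
Proof.
move=> c0 Uo SS; apply: sz_transport => //; first exact: wcontinuous_affine.
by move=> f g *; apply: gap_affine.
Qed.

Lemma linear_affine c h f : linear h -> linear f -> linear (affine_map c h f).
Proof.
move=> hl fl a x y; rewrite /affine_map hl fl /GRing.scale /=; ring.
Qed.

Lemma wopenT : wopen (setT : set (X -> K^o)).
Proof. by move=> f _; exists [::], 1. Qed.

(** If f is in the j-th derived set of level e but not in the next one, some neighbourhood of f
    meets that set in no pair at distance more than e. Dilating this piece by 1/e about f sends it
    into the ball, which n derivations of level d empty; so n derivations of level e d remove f. *)
Lemma sz_submul e d m n : 0 < e -> 0 < d -> sz e m B = set0 -> sz d n B = set0 ->
  sz (e * d) (n * m) B = set0.
Proof.
move=> e0 d0 m0 n0.
suff H j : sz (e * d) (n * j) B `<=` sz e j B.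
  by rewrite -subset0 -m0; exact: H.
elim: j => [|j ih]; first by rewrite muln0.
rewrite mulnS sz_add; apply: subset_trans (sz_mono ih) _.
move=> f fn; apply: contrapT => fN.
have Sf := sz_sub fn.
have [xs [r [r0 rP]]] : exists xs r, 0 < r /\ forall f1 f2, sz e j B f1 -> sz e j B f2 ->
    near_on xs r f f1 -> near_on xs r f f2 -> ~ gap e f1 f2.
  apply: contrapT => nP; apply: fN; apply/szlenk_derivP; split=> // xs r r0.
  apply: contrapT => nf; apply: nP; exists xs, r; split => // f1 f2 S1 S2 n1 n2 g12.
  by apply: nf; exists f1, f2.
have fl : linear f by have /dual_ballP[] := sz_sub Sf.
(* With this h, [affine_map e^-1 h] is g |-> (g - f) / e. *)
pose h := fun x => - emb k e^-1 * f x : K^o.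
have hl : linear h.
  by move=> a x y; rewrite /h fl /GRing.scale /=; ring.
have ei : 0 < e^-1 by rewrite invr_gt0.
have := @sz_affine e^-1 h (e * d) n (sz e j B) B (near_on xs r f) ei.
move=> /(_ (@near_on_wopen _ _ _ _ _ _))/(_ _ f fn (@near_on_refl _ _ _ xs r f r0)).
rewrite mulKf ?gt_eqF // n0; apply => g Sg gn.
have gl : linear g by have /dual_ballP[] := sz_sub Sg.
apply/dual_ballP; split; first exact: linear_affine.
move=> x; rewrite -[leRHS]mul1r.
apply: (linear_bounded_on_ball (linear_affine _ hl gl)) => {}x x1.
rewrite /affine_map /h mulNr addrC -mulrBr nmM nm_emb gtr0_norm //.
rewrite mulrC ler_pdivrMr // mul1r leNgt; apply/negP => eg.
by apply: (rP g f Sg Sf gn (@near_on_refl _ _ _ xs r f r0)); exists x.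
Qed.

(** The nested [affine_map] is the combination d f + c g. *)
Lemma dual_ball_affine c d f g : 0 <= c -> 0 <= d -> c + d <= 1 -> B f -> B g ->
  B (affine_map c (affine_map d (fun=> 0) f) g).
Proof.
move=> c0 d0 cd /dual_ballP[fl f1] /dual_ballP[gl g1]; apply/dual_ballP; split.
  do 2![apply: linear_affine => //].
  by move=> a x y; rewrite scaler0 addr0.
move=> x; rewrite /affine_map add0r; apply: le_trans (nmD _ _) _.
rewrite !nmM !nm_emb !ger0_norm //.
apply: le_trans (_ : (c + d) * rnorm x <= _); last by rewrite ler_piMl // rnorm_ge0.
by rewrite mulrDl addrC lerD // ler_wpM2l.
Qed.

Lemma dual_ball0 : B (fun=> 0).
Proof.
apply/dual_ballP; split; first by move=> a x y; rewrite scaler0 addr0.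
by move=> x; rewrite nm0 rnorm_ge0.
Qed.

(* 0 lies in the derived set of level e/2 by symmetry, and translating a copy of the ball
   contracted by 1/n shows that each (e/2)/n-derivation removes at most the radius 1/n. *)
Lemma sz_linear_growth e n : 0 < e -> sz e 1 B !=set0 ->
  sz (e / 2 / n.+1%:R) n.+1 B !=set0.
Proof.
move=> e0 [f fe]; have Bf := sz_sub fe.
have c0 : 0 < 2^-1 :> R by lra.
(* The map g |-> (g - f) / 2 sends the ball into itself and f to 0, and halves the level. *)
have z1 : sz (e / 2) 1 B (fun=> 0).
  have := @sz_affine 2^-1 (affine_map (- 2^-1) (fun=> 0) f) e 1 B B setT c0 wopenT.
  move=> /(_ _ f fe I); rewrite mulrC.
  have -> : affine_map 2^-1 (affine_map (- 2^-1) (fun=> 0) f) f = fun=> 0.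
    apply/funext => x; rewrite /affine_map add0r -mulrDl -embD.
    by rewrite addNr emb0 mul0r.
  apply => g Bg _.
  have Bnf : B (affine_map (-1) (fun=> 0) f).
    have /dual_ballP[fl f1] := Bf; apply/dual_ballP; split.
      by apply: linear_affine => // a x y; rewrite scaler0 addr0.
    by move=> x; rewrite /affine_map add0r nmM nm_emb normrN1 mul1r.
  suff -> : affine_map (- 2^-1) (fun=> 0) f =
            affine_map 2^-1 (fun=> 0) (affine_map (-1) (fun=> 0) f).
    by apply: dual_ball_affine => //; lra.
  apply/funext => x; rewrite /affine_map !add0r mulrA -embM; congr (emb _ _ * _); lra.
have N0 : 0 < n.+1%:R :> R by rewrite ltr0n.
(* Invariant: after j derivations the ball of radius 1 - j / (n + 1) is still there. *)
suff H j : (j <= n.+1)%N -> forall f, B f ->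
   sz (e / 2 / n.+1%:R) j B (affine_map (1 - j%:R / n.+1%:R) (fun=> 0) f).
  by exists (affine_map (1 - n.+1%:R / n.+1%:R) (fun=> 0) f); exact: H.
elim: j => [|j ih] jn {fe Bf}f Bf.
  suff -> : affine_map (1 - 0%:R / n.+1%:R) (fun=> 0) f = f by [].
  by apply/funext => x; rewrite /affine_map mul0r subr0 emb1 add0r mul1r.
have Ni : 0 < n.+1%:R^-1 :> R by rewrite invr_gt0.
have := @sz_affine n.+1%:R^-1 (affine_map (1 - j.+1%:R / n.+1%:R) (fun=> 0) f) (e / 2) 1 B
  (sz (e / 2 / n.+1%:R) j B) setT Ni wopenT.
move=> /(_ _ _ z1 I); rewrite mulrC.
have -> : affine_map n.+1%:R^-1 (affine_map (1 - j.+1%:R / n.+1%:R) (fun=> 0) f) (fun=> 0) =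
          affine_map (1 - j.+1%:R / n.+1%:R) (fun=> 0) f.
  by apply/funext => x; rewrite /affine_map mulr0 addr0.
apply=> g Bg _.
have jn' : j%:R < n.+1%:R :> R by rewrite ltr_nat.
have j1 : j.+1%:R <= n.+1%:R :> R by rewrite ler_nat.
pose t : R := 1 - j%:R / n.+1%:R.
have t0 : 0 < t by rewrite subr_gt0 ltr_pdivrMr // mul1r.
(* The point (1 - (j + 1) / (n + 1)) f + g / (n + 1) is t times d f + c g with c + d <= 1, so it
   lies in the ball of radius t kept by [ih]. *)
have [c [d [c0' d0 cd ct dt]]] : exists c d : R, [/\ 0 <= c, 0 <= d, c + d <= 1,
    t * c = n.+1%:R^-1 & t * d = 1 - j.+1%:R / n.+1%:R].
  exists (n.+1%:R^-1 / t), ((1 - j.+1%:R / n.+1%:R) / t); split.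
  - by rewrite divr_ge0 // ltW.
  - by rewrite divr_ge0 ?(ltW t0) // subr_ge0 ler_pdivrMr // mul1r.
  - rewrite -mulrDl ler_pdivrMr // mul1r /t.
    have -> : j.+1%:R / n.+1%:R = j%:R / n.+1%:R + n.+1%:R^-1 :> R.
      by rewrite -[j.+1%:R]natr1 mulrDl mul1r.
    by set v := n.+1%:R^-1; move: (j%:R * v) => u; lra.
  - by rewrite mulrC divfK ?gt_eqF.
  - by rewrite mulrC divfK ?gt_eqF.
have := ih (ltnW jn) _ (dual_ball_affine c0' d0 cd Bf Bg).
rewrite [e / 2 / _]mulrC; congr (sz _ _ _ _).
apply/funext => x; rewrite /affine_map !add0r mulrDr !mulrA -!embM.
by rewrite -/t ct dt.
Qed.

End Affine.

(** * Power types *)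

Section Fekete.
Variables (R : realType) (N : R -> nat).
Hypothesis N_gt0 : forall e, 0 < e -> (0 < N e)%N.
Hypothesis N_le : forall e d, 0 < e -> e <= d -> (N d <= N e)%N.
Hypothesis N_mul : forall e d, 0 < e -> 0 < d -> (N (e * d) <= N e * N d)%N.

Let quotients := [set ln (N e)%:R / - ln e | e in [set e : R | 0 < e < 1]].

(** By submultiplicativity the limit of the quotients at 0 is their infimum, which also gives a
    lower bound for N e at every e in (0, 1). *)
Definition growth_exponent : R := inf quotients.

Let lnN_ge0 e : 0 < e -> 0 <= ln (N e)%:R :> R.
Proof. by move=> e0; rewrite ln_ge0 // ler1n N_gt0. Qed.

Let lnV_gt0 (e : R) : 0 < e < 1 -> 0 < - ln e.
Proof. by move=> e01; rewrite oppr_gt0 ln_lt0. Qed.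

Let quotients_inf : has_inf quotients.
Proof.
split; first by exists (ln (N 2^-1)%:R / - ln 2^-1), 2^-1 => //=; lra.
exists 0 => _ [e /= e01 <-]; have [e0 _] := andP e01.
by rewrite divr_ge0 ?lnN_ge0 // ltW // lnV_gt0.
Qed.

Lemma growth_exponent_ge0 : 0 <= growth_exponent.
Proof.
apply: lb_le_inf; first by case: quotients_inf.
move=> _ [e /= e01 <-]; have [e0 _] := andP e01.
by rewrite divr_ge0 ?lnN_ge0 // ltW // lnV_gt0.
Qed.

Lemma growth_exponent_le e : 0 < e < 1 -> growth_exponent * - ln e <= ln (N e)%:R.
Proof.
move=> e01; rewrite -ler_pdivlMr ?lnV_gt0 //.
by apply: ge_inf; [exact: quotients_inf.2|exists e].
Qed.

Lemma growth_exponent_eq0 : (forall e, 0 < e -> N e = 1%N) -> growth_exponent = 0.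
Proof.
move=> N1; apply/eqP; rewrite eq_le growth_exponent_ge0 andbT.
have e01 : 0 < (2^-1 : R) < 1 by lra.
have := growth_exponent_le e01; rewrite N1 ?ln1 ?invr_gt0 //.
by rewrite pmulr_lle0 // lnV_gt0.
Qed.

(** A strictly larger exponent would violate the bound at a single small e. *)
Lemma growth_exponent_le_of_bound (r C e0 : R) : 0 < e0 ->
  (forall e, 0 < e -> e < e0 -> (N e)%:R <= C * expR (r * - ln e)) -> growth_exponent <= r.
Proof.
move=> e00 NC; rewrite leNgt; apply/negP => rp.
pose e1 := Num.min (e0 / 2) 2^-1.
have e10 : 0 < e1 by rewrite lt_min; apply/andP; split; lra.
have C0 : 0 < C.
  have e1e : e1 < e0 by rewrite gt_min; apply/orP; left; lra.
  have := NC _ e10 e1e; rewrite leNgt; apply: contraNT; rewrite -leNgt => C0.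
  apply: le_lt_trans (_ : 0 < _); last by rewrite ltr0n N_gt0.
  by rewrite mulr_le0_ge0 // expR_ge0.
(* Once - ln e >= s, the difference of the exponents contributes at least |ln C| + 1, more than the
   constant ln C can compensate. *)
pose s := (`|ln C| + 1) / (growth_exponent - r).
have pr : 0 < growth_exponent - r by rewrite subr_gt0.
have s0 : 0 < s by rewrite divr_gt0 // ltr_wpDl.
pose e := Num.min e1 (expR (- s)).
have e_gt0 : 0 < e by rewrite lt_min e10 expR_gt0.
have e01 : 0 < e < 1.
  by rewrite e_gt0 /= gt_min; apply/orP; left; rewrite gt_min; apply/orP; right; lra.
have ee0 : e < e0 by rewrite !gt_min; apply/orP; left; apply/orP; left; lra.
have se : s <= - ln e.
  by rewrite lerNr -[leRHS]expRK ler_ln ?posrE ?expR_gt0 // ge_min lexx orbT.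
have N0 : 0 < (N e)%:R :> R by rewrite ltr0n N_gt0.
have := NC e e_gt0 ee0; rewrite -ler_ln ?posrE ?mulr_gt0 ?expR_gt0 //.
rewrite lnM ?posrE ?expR_gt0 // expRK => h.
have := le_trans (growth_exponent_le e01) h.
rewrite -lerBlDr -mulrBl => h2.
have := le_trans (ler_wpM2l (ltW pr) se) h2.
rewrite /s mulrC divfK ?gt_eqF // => h3.
have := ler_norm (ln C); lra.
Qed.

Let N_exp e n : 0 < e -> (N (e ^+ n.+1) <= N e ^ n.+1)%N.
Proof.
move=> e0; elim: n => [|n ih]; first by rewrite expr1 expn1.
rewrite exprS expnS; apply: leq_trans (N_mul _ _) _ => //; first by rewrite exprn_gt0.
by rewrite leq_mul2l ih orbT.
Qed.

(** With m the integer part of ln e / ln d one has d^(m+1) <= e, so N e <= N (d^(m+1)) <= (N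
    d)^(m+1). *)
Let ln_N_le e d : 0 < e < 1 -> 0 < d < 1 ->
  ln (N e)%:R <= (- ln e / - ln d + 1) * ln (N d)%:R.
Proof.
move=> e01 d01; have [[e0 _] [d0 d1]] := (andP e01, andP d01).
have q0 : 0 <= - ln e / - ln d by rewrite divr_ge0 // ltW // lnV_gt0.
pose m := Num.truncn (- ln e / - ln d).
have /andP[m1 m2] : m%:R <= - ln e / - ln d < m.+1%:R by exact: truncn_itv.
have N0 a : 0 < a -> 0 < (N a)%:R :> R by move=> a0; rewrite ltr0n N_gt0.
apply: le_trans (_ : m.+1%:R * ln (N d)%:R <= _); last first.
  by rewrite ler_wpM2r ?lnN_ge0 // -natr1 lerD2r.
rewrite mulr_natl -lnXn ?N0 // ler_ln ?posrE ?exprn_gt0 ?N0 //.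
rewrite -natrX ler_nat; apply: leq_trans (N_exp m d0).
apply: N_le; first by rewrite exprn_gt0.
rewrite -ler_ln ?posrE ?exprn_gt0 // lnXn // -mulr_natl.
by move: m2; rewrite ltr_pdivrMr ?lnV_gt0 // mulrN ltrN2 => /ltW.
Qed.

(** Take d with quotient below r and compare e with the powers of d; the rounding leaves one factor
    N d, which is the constant C. *)
Lemma growth_exponent_bound (r : R) : growth_exponent < r ->
  exists2 C, 0 < C & forall e, 0 < e < 1 -> (N e)%:R <= C * expR (r * - ln e).
Proof.
move=> pr; have r0 : 0 < r - growth_exponent by rewrite subr_gt0.
have [_ [d /= d01 <-]] := inf_adherent r0 quotients_inf.
rewrite -/growth_exponent addrC subrK => dr.
have [d0 d1] := andP d01.
have Nd0 : 0 < (N d)%:R :> R by rewrite ltr0n N_gt0.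
exists (N d)%:R => // e e01; have [e0 e1] := andP e01.
have Ne0 : 0 < (N e)%:R :> R by rewrite ltr0n N_gt0.
rewrite -ler_ln ?posrE ?mulr_gt0 ?expR_gt0 // lnM ?posrE ?expR_gt0 // expRK.
apply: le_trans (ln_N_le e01 d01) _.
rewrite mulrDl mul1r addrC lerD2l mulrAC -mulrA mulrC ler_wpM2r //.
  by rewrite ltW // lnV_gt0.
exact: ltW.
Qed.

Lemma growth_exponent_cvg :
  (fun e : R => ln (N e)%:R / `|ln e|) @ 0^'+ --> growth_exponent.
Proof.
apply/cvgrPdist_lt => d d0.
have d2 : 0 < d / 2 by lra.
have [_ [a /= a01 <-]] := inf_adherent d2 quotients_inf.
rewrite -/growth_exponent => ad.
have [a0 a1] := andP a01; have la := lnV_gt0 a01.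
(* For e < c the error term ln (N a) / (- ln e) is below d / 2; the + 1 keeps c < 1 even when N a =
   1. *)
pose c := expR (- (2 * (ln (N a)%:R + 1) / d)).
have c0 : 0 < c by exact: expR_gt0.
have c1 : c < 1.
  by rewrite /c expR_lt1 oppr_lt0 divr_gt0 // mulr_gt0 // ltr_wpDl // lnN_ge0.
near=> e.
have e0 : 0 < e by near: e; exact: nbhs_right_gt.
have ec : e < c by near: e; apply: nbhs_right_lt.
have e01 : 0 < e < 1 by rewrite e0 (lt_trans ec).
have le := lnV_gt0 e01.
have lec : 2 * (ln (N a)%:R + 1) / d < - ln e.
  by rewrite ltrNr -[ltRHS]expRK ltr_ln ?posrE.
rewrite (@ltr0_norm _ (ln e)) -?oppr_gt0 //.
have h1 : growth_exponent <= ln (N e)%:R / - ln e.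
  by rewrite ler_pdivlMr // growth_exponent_le.
have h2 : ln (N e)%:R / - ln e <= ln (N a)%:R / - ln a + ln (N a)%:R / - ln e.
  rewrite ler_pdivrMr // mulrDl divfK ?gt_eqF //.
  apply: le_trans (ln_N_le e01 a01) _.
  by rewrite mulrDl mul1r lerD2r [leLHS]mulrC mulrA mulrAC.
have h3 : ln (N a)%:R / - ln e < d / 2.
  rewrite ltr_pdivrMr //; move: lec; rewrite ltr_pdivrMr // => lec.
  have := lnN_ge0 a0; lra.
rewrite distrC ger0_norm ?subr_ge0 //; lra.
Unshelve. all: by end_near.
Qed.

End Fekete.

(** * The Szlenk power type as a growth exponent *)

Section PowerType.
Variables (R : realType) (k : scalar_kind) (X : normedModType (scalar_field R k)).
Local Notation K := (scalar_field R k).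
Local Notation B := (@dual_ball R k X).
Hypothesis X_fin : forall e, 0 < e -> szlenk_fin X e.

Local Notation N := (szlenk_nat X).

Lemma szlenk_nat_le_of e n : 0 < e -> sz e n B = set0 -> (N e <= n)%N.
Proof. by move=> /X_fin/szlenk_natP[_]; apply. Qed.

Lemma sz_szlenk_nat e : 0 < e -> sz e (N e) B = set0.
Proof. by move=> /X_fin/szlenk_natP[]. Qed.

Lemma szlenk_nat_gt0 e : 0 < e -> (0 < N e)%N.
Proof.
move=> /sz_szlenk_nat; case: (N e) => //= B0.
by have := @dual_ball0 R k X; rewrite -[B]/(sz e 0 B) B0.
Qed.

Lemma szlenk_nat_mono e d : 0 < e -> e <= d -> (N d <= N e)%N.
Proof.
move=> e0 ed; apply: szlenk_nat_le_of; first exact: lt_le_trans ed.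
by rewrite -subset0 -(sz_szlenk_nat e0); apply: sz_le.
Qed.

Lemma szlenk_nat_mul e d : 0 < e -> 0 < d -> (N (e * d) <= N e * N d)%N.
Proof.
move=> e0 d0; apply: szlenk_nat_le_of; first exact: mulr_gt0.
by rewrite mulnC; apply: sz_submul => //; exact: sz_szlenk_nat.
Qed.

Lemma power_typeE : power_type X = growth_exponent N.
Proof.
apply: cvg_lim => //; apply: growth_exponent_cvg.
- exact: szlenk_nat_gt0.
- exact: szlenk_nat_mono.
- exact: szlenk_nat_mul.
Qed.

Lemma power_type_ge0 : 0 <= power_type X.
Proof. by rewrite power_typeE; apply: growth_exponent_ge0; exact: szlenk_nat_gt0. Qed.

Lemma power_type_bound (r : R) : power_type X < r ->
  exists2 C, 0 < C & forall e, 0 < e < 1 -> (N e)%:R <= C * expR (r * - ln e).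
Proof.
rewrite power_typeE; apply: growth_exponent_bound.
- exact: szlenk_nat_gt0.
- exact: szlenk_nat_mono.
- exact: szlenk_nat_mul.
Qed.

Lemma power_type_le_of_bound (r C e0 : R) : 0 < e0 ->
  (forall e, 0 < e -> e < e0 -> (N e)%:R <= C * expR (r * - ln e)) -> power_type X <= r.
Proof.
rewrite power_typeE; apply: growth_exponent_le_of_bound; exact: szlenk_nat_gt0.
Qed.

Lemma power_type_eq0 : (forall e, 0 < e -> N e = 1%N) -> power_type X = 0.
Proof. by rewrite power_typeE; apply: growth_exponent_eq0; exact: szlenk_nat_gt0. Qed.

(** A dichotomy: if one derivation of level e leaves a nonempty set, [sz_linear_growth] keeps d N(d)
    bounded below as d tends to 0, and the exponent is at least 1. *)
Lemma szlenk_nat_eq1 : power_type X < 1 -> forall e, 0 < e -> N e = 1%N.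
Proof.
move=> p1 e e0; apply/eqP; rewrite eqn_leq szlenk_nat_gt0 // andbT.
apply: szlenk_nat_le_of => //; apply: contrapT => /eqP/set0P ne.
pose r := (power_type X + 1) / 2.
have pr : power_type X < r by rewrite /r; lra.
have r1 : r < 1 by rewrite /r; lra.
have [C C0 NC] := power_type_bound pr.
have e2 : 0 < e / 2 by lra.
suff : 1 <= r by lra.
have [D D0 DP] : exists2 D, 0 < D & forall d, 0 < d -> d < e / 2 -> D <= d * (N d)%:R.
  exists (e / 4); first lra.
  (* For m > 0, d is at most e / 2 / m, so the m-th derived set of level d is nonempty and N d
     exceeds m. *)
  move=> d d0 de; pose m := Num.truncn (e / 2 / d).
  have q0 : 0 <= e / 2 / d by rewrite ltW // divr_gt0.
  have /andP[m1 m2] : m%:R <= e / 2 / d < m.+1%:R by exact: truncn_itv.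
  have mN : (m < N d)%N.
    case: m m1 m2 => [|m] m1 m2; first exact: szlenk_nat_gt0.
    rewrite ltnNge; apply/negP => Nm.
    have [f fP] := sz_linear_growth m e0 ne.
    have : sz d m.+1 B f.
      apply: sz_le fP; rewrite ler_pdivlMr ?ltr0n // mulrC.
      by move: m1; rewrite ler_pdivlMr.
    by move=> /(sz_leq Nm); rewrite sz_szlenk_nat.
  move: m2; rewrite ltr_pdivrMr // => m2.
  have : m.+1%:R <= (N d)%:R :> R by rewrite ler_nat.
  move=> /(ler_wpM2r (ltW d0)); rewrite [_ * d in leRHS]mulrC; lra.
have r1' : 0 < 1 - r by lra.
(* s is so large that d = exp(- s) lies below 1 and e / 2, and that D <= d C d^(- r) fails. *)
pose s := Num.max (- ln (e / 2) + 1) (Num.max 1 ((ln C - ln D + 1) / (1 - r))).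
have s1 : - ln (e / 2) + 1 <= s by rewrite le_max lexx.
have s2 : 1 <= s by rewrite !le_max lexx !orbT.
have s3 : ln C - ln D + 1 <= s * (1 - r) by rewrite -ler_pdivrMr // !le_max lexx !orbT.
pose d := expR (- s).
have d0 : 0 < d by exact: expR_gt0.
have d1 : d < 1 by rewrite expR_lt1; lra.
have de : d < e / 2 by rewrite -ltr_ln ?posrE // expRK; lra.
have d01 : 0 < d < 1 by rewrite d0.
have := le_trans (DP _ d0 de) (ler_wpM2l (ltW d0) (NC _ d01)).
rewrite -ler_ln ?posrE ?mulr_gt0 ?expR_gt0 // !lnM ?posrE ?mulr_gt0 ?expR_gt0 // !expRK.
rewrite opprK; lra.
Qed.

End PowerType.

(** * Nonzero functionals *)

Section HahnBanach.
Variables (R : realType) (k : scalar_kind) (V : normedModType (scalar_field R k)).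
Local Notation K := (scalar_field R k).
Implicit Types (p q : V -> R) (x y a : V).

(** Homogeneity concerns real scalars only, so one argument covers real spaces and complex spaces
    seen as real ones. *)
Definition sublinear p := (forall x y, p (x + y) <= p x + p y) /\
  (forall c x, 0 <= c -> p (emb k c *: x) <= c * p x).

Lemma sublinear0 p : sublinear p -> p 0 = 0.
Proof.
move=> [pD pZ]; apply/eqP; rewrite eq_le.
have := pZ 0 0 (lexx _); rewrite emb0 scale0r mul0r => -> /=.
by have := pD 0 0; rewrite addr0; lra.
Qed.

Lemma sublinear_ge p x : sublinear p -> - p (- x) <= p x.
Proof. by move=> sp; have := sp.1 x (- x); rewrite subrr sublinear0 //; lra. Qed.

Lemma sublinearZ p c x : sublinear p -> 0 <= c -> p (emb k c *: x) = c * p x.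
Proof.
move=> sp; rewrite le_eqVlt => /orP[/eqP<-|c0].
  by rewrite emb0 scale0r mul0r sublinear0.
apply/eqP; rewrite eq_le sp.2 ?(ltW c0) //=.
have := sp.2 c^-1 (emb k c *: x); rewrite invr_ge0 (ltW c0) => /(_ isT).
by rewrite scalerA -embM mulVf ?gt_eqF // emb1 scale1r mulrC ler_pdivlMr // mulrC.
Qed.

Lemma sublinear_rnorm : sublinear (@rnorm R k V).
Proof.
split=> [x y|c x c0]; first exact: rnormD.
by rewrite rnormZ nm_emb ger0_norm.
Qed.

(** Of two members of the chain nearly optimal at x and at y, the smaller serves both points, which
    gives subadditivity; the bound by q keeps the infimum finite. *)
Lemma sublinear_inf (A : set (V -> R)) q : A !=set0 ->
  (forall p, A p -> sublinear p /\ forall x, p x <= q x) ->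
  (forall p p', A p -> A p' -> (forall x, p x <= p' x) \/ (forall x, p' x <= p x)) ->
  let m := fun x => inf [set p x | p in A] in
  sublinear m /\ forall p, A p -> forall x, m x <= p x.
Proof.
move=> [p0 Ap0] Aq Achain m.
have lb x : has_lbound [set p x | p in A].
  exists (- q (- x)) => _ [p Ap <-]; have [sp pq] := Aq p Ap.
  by apply: le_trans (sublinear_ge x sp); rewrite lerN2.
have ml p x : A p -> m x <= p x by move=> Ap; apply: ge_inf => //; exists p.
have hi x : has_inf [set p x | p in A] by split => //; exists (p0 x), p0.
have madh x d : 0 < d -> exists2 p, A p & p x < m x + d.
  by move=> d0; have [_ [p Ap <-] pd] := inf_adherent d0 (hi x); exists p.
split; last by move=> p Ap x; exact: ml.
split.
  move=> x y; apply/ler_addgt0Pr => d d0; have d2 : 0 < d / 2 by lra.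
  have [p Ap px] := madh x _ d2; have [p' Ap' py] := madh y _ d2.
  have [h|h] := Achain p p' Ap Ap'.
    have := (Aq p Ap).1.1 x y; have := ml p (x + y) Ap; have := h y; lra.
  have := (Aq p' Ap').1.1 x y; have := ml p' (x + y) Ap'; have := h x; lra.
move=> c x; rewrite le_eqVlt => /orP[/eqP<-|c0].
  apply: le_trans (ml p0 _ Ap0) _; rewrite emb0 scale0r mul0r sublinear0 //.
  exact: (Aq _ Ap0).1.
rewrite -ler_pdivrMl //; apply: lb_le_inf; first by exists (p0 x), p0.
move=> _ [p Ap <-]; rewrite ler_pdivrMl //.
by apply: le_trans (ml p _ Ap) _; apply: (Aq p Ap).1.2; exact: ltW.
Qed.

(** Zorn's lemma for the reversed pointwise order, where infima bound the chains. *)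
Lemma minimal_sublinear q : sublinear q -> exists p, [/\ sublinear p,
  forall x, p x <= q x &
  forall p', sublinear p' -> (forall x, p' x <= p x) -> p' = p].
Proof.
move=> sq; pose T := {p : V -> R | sublinear p /\ forall x, p x <= q x}.
have [| | | |[p [sp pq]] pmin] := @Zorn T (fun s t => `[< forall x, sval t x <= sval s x >]).
- by move=> t; apply/asboolP.
- move=> r s t /asboolP rs /asboolP st; apply/asboolP => x.
  exact: le_trans (st x) (rs x).
- move=> [s sP] [t tP] /asboolP /= st /asboolP /= ts.
  by apply: eq_exist => /=; apply/funext => x; apply/eqP; rewrite eq_le st ts.
- move=> A Atot; have [[t0 At0]|A0] := pselect (A !=set0); last first.
    exists (exist _ q (conj sq (fun x => lexx _))) => s As.
    by exfalso; apply: A0; exists s.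
  pose A' := [set sval t | t in A].
  have [|||sm mA] := @sublinear_inf A' q.
  + by exists (sval t0), t0.
  + by move=> _ [t At <-]; exact: (svalP t).
  + move=> _ _ [s As <-] [t At <-].
    by have [/asboolP|/asboolP] := Atot s t As At; [right|left].
  have mq x : inf [set p x | p in A'] <= q x.
    apply: le_trans ((svalP t0).2 x); apply: mA; by exists t0.
  exists (exist (fun p => sublinear p /\ forall x, p x <= q x) _ (conj sm mq)) => s As.
  apply/asboolP => x /=.
  by apply: mA; exists s.
exists p; split => // p' sp' pp'.
have p'q x : p' x <= q x by apply: le_trans (pq x).
have := pmin (exist _ p' (conj sp' p'q)).
by move=> /(_ _)/(congr1 sval); apply; apply/asboolP.
Qed.

(** The functional is x |-> inf over t >= 0 of p (x + t a) - t p a; t = 0 and t = 1 give the two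
    bounds. *)
Lemma sublinear_shift p a : sublinear p -> exists p', [/\ sublinear p',
  forall x, p' x <= p x & forall x, p' x <= p (x + a) - p a].
Proof.
move=> sp.
pose E x := [set p (x + emb k t *: a) - t * p a | t in [set t | 0 <= t]].
have lb x : has_lbound (E x).
  exists (- p (- x)) => _ [t /= t0 <-]; rewrite -(sublinearZ a sp t0).
  have := sp.1 (x + emb k t *: a) (- x).
  rewrite addrAC subrr add0r; lra.
have el x t : 0 <= t -> inf (E x) <= p (x + emb k t *: a) - t * p a.
  by move=> t0; apply: ge_inf => //; exists t.
have ne x : E x !=set0 by exists (p (x + emb k 0 *: a) - 0 * p a), 0 => /=.
have adh x d : 0 < d -> exists2 t, 0 <= t & p (x + emb k t *: a) - t * p a < inf (E x) + d.
  move=> d0; have [|_ [t t0 <-] td] := @inf_adherent _ (E x) _ d0; first by split.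
  by exists t.
exists (fun x => inf (E x)); split; first split.
- move=> x y; apply/ler_addgt0Pr => d d0; have d2 : 0 < d / 2 by lra.
  have [s s0 sx] := adh x _ d2; have [t t0 ty] := adh y _ d2.
  have := el (x + y) _ (addr_ge0 s0 t0).
  rewrite embD scalerDl addrACA => h.
  have := sp.1 (x + emb k s *: a) (y + emb k t *: a); lra.
- move=> c x; rewrite le_eqVlt => /orP[/eqP<-|c0].
    have := el 0 _ (lexx _); rewrite emb0 !scale0r addr0 !mul0r subr0 sublinear0 //.
  rewrite -ler_pdivrMl //; apply: lb_le_inf => // _ [t /= t0 <-].
  rewrite ler_pdivrMl //; have := el (emb k c *: x) _ (mulr_ge0 (ltW c0) t0).
  by rewrite embM -scalerA -scalerDr sublinearZ ?(ltW c0) // mulrBr mulrA.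
- by move=> x; have := el x _ (lexx _); rewrite emb0 scale0r addr0 mul0r subr0.
- by move=> x; have := el x _ ler01; rewrite emb1 scale1r mul1r.
Qed.

(** Shift the norm by a, so that q (- a) <= - |a|, and take p minimal below q. By minimality every
    shift of p is p itself, which reads p x + p y <= p (x + y): p is additive. *)
Lemma real_hahn_banach a : exists u : V -> R, [/\ {morph u : x y / x + y},
  forall c x, u (emb k c *: x) = c * u x, forall x, `|u x| <= rnorm x & u a = rnorm a].
Proof.
have [q [sq qn qa]] := sublinear_shift a sublinear_rnorm.
have [p [sp pq pmin]] := minimal_sublinear sq.
have pn x : p x <= rnorm x by apply: le_trans (qn x).
have pD x y : p (x + y) = p x + p y.
  apply/eqP; rewrite eq_le sp.1 /=; have [p' [sp' p'p p'y]] := sublinear_shift y sp.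
  by have := p'y x; rewrite (pmin _ sp' p'p) lerBrDr.
have pN x : p (- x) = - p x.
  by have := pD x (- x); rewrite subrr sublinear0 //; lra.
exists p; split => //.
- move=> c x; have [c0|c0] := leP 0 c; first exact: sublinearZ.
  rewrite -[c]opprK mulNr -sublinearZ ?oppr_ge0 ?(ltW c0) // -pN -scaleNr.
  have -> : - emb k (- c) = emb k (- - c).
    by apply/eqP; rewrite eq_sym -addr_eq0 -embD addNr emb0.
  by [].
- by move=> x; rewrite ler_norml pn andbT -(rnormN x) lerNl -pN pn.
- apply/eqP; rewrite eq_le pn /=.
  have := qa (- a); rewrite addNr rnorm0 sub0r => h.
  by have := le_trans (pq (- a)) h; rewrite pN lerN2.
Qed.

End HahnBanach.

Lemma exists_dual_ball_neq0 (R : realType) (k : scalar_kind)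
    (V : normedModType (scalar_field R k)) (a : V) : a != 0 ->
  exists2 g, @dual_ball R k V g & g a != 0.
Proof.
move=> a0; have := rnorm_gt0 a0; have [u [uD uZ un ua]] := real_hahn_banach a.
rewrite -ua => ua0 {a0 ua}; move: V a u uD uZ un ua0; case: k => V a u uD uZ un ua0.
  exists u; last by rewrite gt_eqF.
  apply/dual_ballP; split; first by move=> c x y; rewrite uD uZ.
  exact: un.
pose i : R[i] := (0 +i* 1)%C.
(* The complexification of u is halved so that the crude estimate |Re| + |Im| keeps it in the dual
   ball; only its nonvanishing at a matters. *)
pose g x : R[i]^o := (u x / 2 +i* (- u (i *: x) / 2))%C.
exists g; last first.
  by apply/eqP => /(congr1 (@complex.Re R)) /=; lra.
apply/dual_ballP; split.
  move=> [c d] x y; rewrite /g.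
  have cd : (c +i* d)%C = real_complex R c + real_complex R d * i.
    by apply/eqP; rewrite eq_complex /=; apply/andP; split; apply/eqP; ring.
  have e1 : u ((c +i* d)%C *: x + y) = c * u x + d * u (i *: x) + u y.
    by rewrite uD cd scalerDl uD -scalerA (uZ c) (uZ d).
  have e2 : u (i *: ((c +i* d)%C *: x + y)) = c * u (i *: x) - d * u x + u (i *: y).
    rewrite scalerDr uD scalerA.
    have -> : i * (c +i* d)%C = real_complex R (- d) + real_complex R c * i.
      by apply/eqP; rewrite eq_complex /=; apply/andP; split; apply/eqP; ring.
    by rewrite scalerDl uD -scalerA (uZ c) (uZ (- d)) mulNr; ring.
  rewrite e1 e2; apply/eqP; rewrite eq_complex /=; apply/andP; split; apply/eqP; by field.
move=> x.
have -> : nm (k := ComplexScalars) (g x) = complex.Re (`|g x : R[i]|) by [].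
rewrite normc_def /=.
have ni : rnorm (i *: x : V) = rnorm x.
  rewrite rnormZ; have -> : nm (k := ComplexScalars) i = complex.Re (`|i : R[i]|) by [].
  by rewrite normc_def /= expr0n /= expr1n add0r sqrtr1 mul1r.
have u1 := un x; have u2 := un (i *: x); rewrite ni in u2.
apply: le_trans (_ : `|u x / 2| + `|- u (i *: x) / 2| <= _).
  rewrite -[leRHS]ger0_norm ?addr_ge0 // -sqrtr_sqr ler_wsqrtr //.
  by rewrite [leRHS]sqrrD !real_normK ?num_real // lerD2r lerDl mulrn_wge0 // mulr_ge0.
rewrite !normrM normrN (@ger0_norm _ 2^-1); lra.
Qed.

(** * Levels and formal tensors *)

Section Levels.
Variables (R : realType) (k : scalar_kind) (X : normedModType (scalar_field R k)).
Local Notation K := (scalar_field R k).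
Local Notation B := (@dual_ball R k X).
Hypothesis X_fin : forall e, 0 < e -> szlenk_fin X e.

Definition level (e : R) (f : X -> K^o) : nat :=
  xget 0%N [set m | sz e m B f /\ ~ sz e m.+1 B f].

Lemma levelP e f : 0 < e -> B f -> sz e (level e f) B f /\ ~ sz e (level e f).+1 B f.
Proof.
move=> /X_fin[n n0] Bf; rewrite /level; case: xgetP => [m _ //|noex]; exfalso.
suff H m : sz e m B f by have := H n; rewrite n0.
elim: m => [//|m ih]; apply: contrapT => nm.
by apply: (noex m).
Qed.

Lemma level_lt e f : 0 < e -> B f -> (level e f < szlenk_nat X e)%N.
Proof.
move=> e0 Bf; rewrite ltnNge; apply/negP => Nl.
have [/(sz_leq Nl)] := levelP e0 Bf.
by rewrite sz_szlenk_nat.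
Qed.

Section UltraJump.
Variables (I : Type) (U : set_system I) (FU : UltraFilter U) (F : I -> X -> K^o).
Variable f0 : X -> K^o.
Hypothesis UF : U [set i | B (F i)].
Hypothesis Uf0 : forall xs d, 0 < d -> U [set i | near_on xs d f0 (F i)].

Let Bf0 : B f0.
Proof. exact: ultra_wclosed (@dual_ball_wclosed _ _ _) Uf0 UF. Qed.

(** Let m be the level of f0. If almost all F i had level above m, so would f0, by closedness. If
    almost all had level m and a gap to f0, the pairs (F i, f0) would put f0 into the derived set m
    + 1. *)
Lemma ultra_level_jump e : 0 < e ->
  U [set i | (level e (F i) + `[< gap e (F i) f0 >] <= level e f0)%N].
Proof.
move=> e0; set A := (X in U X); have [//|UnA] := in_ultra_setVsetC A FU; exfalso.
have [l1 l2] := levelP e0 Bf0; set m := level e f0 in l1 l2 A UnA.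
have clo n : wclosed (sz e n B) by apply: sz_wclosed; exact: dual_ball_wclosed.
have [U1|U1] := in_ultra_setVsetC [set i | sz e m.+1 B (F i)] FU.
  by apply: l2; exact: ultra_wclosed (clo _) Uf0 U1.
have U2 : U [set i | sz e m B (F i) /\ gap e (F i) f0].
  apply: filterS (filterI UF (filterI UnA U1)) => i [/= BF [/negP]].
  rewrite -ltnNge => lt nS.
  have [fl _] := levelP e0 BF.
  have lm : (level e (F i) <= m)%N.
    by rewrite leqNgt; apply/negP => ml; apply: nS; exact: (sz_leq ml fl).
  case: (asboolP (gap e (F i) f0)) lt => [g|ng]; last by rewrite addn0 ltnNge lm.
  by rewrite addn1 ltnS => ml; split=> //; exact: (sz_leq ml fl).
apply: l2; apply/szlenk_derivP; split => // xs d d0.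
have [i [/= [iS ig] ni]] := filter_ex (filterI U2 (Uf0 xs d0)).
exists (F i), f0; split => //; exact: near_on_refl.
Qed.

End UltraJump.

(** Dyadic substitute for the integral of [level s f] over the scales s from 2^-J to 1. *)
Definition potential (J : nat) (f : X -> K^o) : R :=
  \sum_(j < J.+1) 2^-1 ^+ j * (level (2^-1 ^+ j) f)%:R.

Lemma dyadic_gt0 j : 0 < 2^-1 ^+ j :> R.
Proof. by rewrite exprn_gt0 // invr_gt0. Qed.

Lemma potential_le J f : B f ->
  potential J f <= \sum_(j < J.+1) 2^-1 ^+ j * (szlenk_nat X (2^-1 ^+ j) - 1)%:R.
Proof.
move=> Bf; apply: ler_sum => j _; rewrite ler_wpM2l ?(ltW (dyadic_gt0 _)) //.
have lN := level_lt (dyadic_gt0 j) Bf.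
by rewrite ler_nat -ltnS subn1 prednK //; apply: leq_ltn_trans lN.
Qed.

(** A jump of size c crosses all scales 2^-j < c, which sum to at least c / 2 up to the truncation
    loss 2^-J; the bound 2 is the diameter of the dual ball. *)
Lemma dyadic_approx J (c : R) : c <= 2 ->
  c / 2 - 2^-1 ^+ J <= \sum_(j < J.+1) 2^-1 ^+ j * (2^-1 ^+ j < c)%R%:R.
Proof.
move=> c2; elim: J => [|J ih].
  by rewrite big_ord_recr big_ord0 /= expr0 add0r; case: (1 < c) => /=; lra.
rewrite big_ord_recr /=; have [h|h] := ltP (2^-1 ^+ J.+1) c; last first.
  rewrite mulr0 addr0; apply: le_trans (_ : 0 <= _).
    have := dyadic_gt0 J.+1; lra.
  by apply: sumr_ge0 => j _; rewrite mulr_ge0 // ltW // dyadic_gt0.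
rewrite mulr1; move: ih; rewrite exprS; lra.
Qed.

Lemma ultra_potential_jump (I : Type) (U : set_system I) (FU : UltraFilter U)
    (F : I -> X -> K^o) (f0 : X -> K^o) (J : nat) :
  U [set i | B (F i)] -> (forall xs d, 0 < d -> U [set i | near_on xs d f0 (F i)]) ->
  U [set i | 0 <= potential J f0 - potential J (F i) /\ forall x, nm (F i x - f0 x) <=
       2 * (potential J f0 - potential J (F i) + 2^-1 ^+ J) * rnorm x].
Proof.
move=> UF Uf0; have Bf0 := ultra_wclosed FU (@dual_ball_wclosed _ _ _) Uf0 UF.
have H : U [set i | forall j : 'I_J.+1, (level (2^-1 ^+ j) (F i) +
     `[< gap (2^-1 ^+ j) (F i) f0 >] <= level (2^-1 ^+ j) f0)%N].
  by apply: filter_forall => j; apply: ultra_level_jump => //; exact: dyadic_gt0.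
apply: filterS (filterI UF H) => i [/= BF lv].
have /dual_ballP[Fl F1] := BF; have /dual_ballP[fl f1] := Bf0.
(* Each scale 2^-j below |F i x - f0 x| is a gap, so it raises the level at that scale by one. *)
have jump x : rnorm x <= 1 ->
    \sum_(j < J.+1) 2^-1 ^+ j * (2^-1 ^+ j < nm (F i x - f0 x))%R%:R <=
    potential J f0 - potential J (F i).
  move=> x1; rewrite /potential -sumrB; apply: ler_sum => j _.
  rewrite -mulrBr ler_wpM2l ?(ltW (dyadic_gt0 _)) // lerBrDl -natrD ler_nat.
  apply: leq_trans (lv j); rewrite leq_add2l.
  case: ltP => // h; rewrite lt0b; apply/asboolP; by exists x.
split.
  apply: le_trans (jump 0 _); last by rewrite rnorm0.
  by apply: sumr_ge0 => j _; rewrite mulr_ge0 // ltW // dyadic_gt0.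
have dl : linear (fun x => F i x - f0 x : K^o).
  by move=> a x y; rewrite Fl fl /GRing.scale /=; ring.
apply: (linear_bounded_on_ball dl) => x x1.
have c2 : nm (F i x - f0 x) <= 2.
  apply: le_trans (nmD _ _) _; rewrite nmN; have := F1 x; have := f1 x; lra.
have := dyadic_approx J c2; have := jump x x1; lra.
Qed.

End Levels.

(** * Formal tensors and their injective norm *)

Section FormalTensors.
Variables (R : realType) (k : scalar_kind).
Local Notation K := (scalar_field R k).
Variables (X Y T : completeNormedModType K) (tau : X -> Y -> T).
Hypothesis T_tensor : is_injective_tensor tau.
Local Notation BX := (@dual_ball R k X).
Local Notation BY := (@dual_ball R k Y).
Local Notation BT := (@dual_ball R k T).
Implicit Types (w : seq (X * Y)) (f : X -> K^o) (g : Y -> K^o).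

(** The value of f (x) g at the formal tensor w, available without extending f (x) g to [T]. *)
Definition ev w f g : K := \sum_(p <- w) f p.1 * g p.2.
Definition elt w : T := \sum_(p <- w) tau p.1 p.2.
Definition fscale (a : K) w : seq (X * Y) := [seq (a *: p.1, p.2) | p <- w].

Lemma ev_cat w w' f g : ev (w ++ w') f g = ev w f g + ev w' f g.
Proof. by rewrite /ev big_cat. Qed.

Lemma elt_cat w w' : elt (w ++ w') = elt w + elt w'.
Proof. by rewrite /elt big_cat. Qed.

Lemma ev_scale a w f g : linear f -> ev (fscale a w) f g = a * ev w f g.
Proof.
move=> fl; rewrite /ev big_map mulr_sumr; apply: eq_bigr => p _ /=.
by rewrite linear_funZ // mulrA.
Qed.

Lemma tau0l y : tau 0 y = 0.
Proof.
have := inj_tensor_linear_l T_tensor y 1 0 0; rewrite !scale1r addr0 => /eqP.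
by rewrite -subr_eq0 opprD addrA subrr sub0r oppr_eq0 => /eqP.
Qed.

Lemma elt_scale a w : elt (fscale a w) = a *: elt w.
Proof.
rewrite /elt big_map scaler_sumr; apply: eq_bigr => p _ /=.
by have := inj_tensor_linear_l T_tensor p.2 a p.1 0; rewrite tau0l !addr0.
Qed.

Lemma elt_norm w : (rnorm (elt w))%:E =
  ereal_sup [set (nm (ev w f g))%:E | f in BX & g in BY].
Proof.
have := inj_tensor_norm T_tensor (fun i => (tnth (in_tuple w) i).1)
  (fun i => (tnth (in_tuple w) i).2).
rewrite /elt (big_tnth _ _ w) => ->; congr ereal_sup.
by apply/seteqP; split=> _ [f Bf [g Bg <-]]; exists f => //; exists g => //;
  rewrite /ev (big_tnth _ _ w).
Qed.

Lemma ev_le w f g : BX f -> BY g -> nm (ev w f g) <= rnorm (elt w).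
Proof.
move=> Bf Bg; rewrite -lee_fin elt_norm; apply: ereal_sup_ubound.
by exists f => //; exists g.
Qed.

Lemma ev_adherent w d : 0 < d ->
  exists f g, [/\ BX f, BY g & rnorm (elt w) - d < nm (ev w f g)].
Proof.
move=> d0; have : ((rnorm (elt w) - d)%:E <
    ereal_sup [set (nm (ev w f g))%:E | f in BX & g in BY])%E.
  by rewrite -elt_norm lte_fin ltrBlDr ltrDl.
by move=> /ereal_sup_gt[_ [f Bf [g Bg <-]]]; rewrite lte_fin => h; exists f, g.
Qed.

Lemma elt_dense (t : T) d : 0 < d -> exists w, rnorm (elt w - t) < d.
Proof.
move=> d0; have : nbhs t [set s : T | rnorm (s - t) < d] by apply/nbhs_rnormP; exists d.
rewrite nbhsE => -[U [oU Ut] Ud].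
have [|s [Us [n [x [y sE]]]]] := inj_tensor_dense T_tensor _ oU; first by exists t.
exists [seq (x i, y i) | i <- enum 'I_n].
have -> : elt [seq (x i, y i) | i <- enum 'I_n] = s.
  by rewrite /elt big_map /= sE big_enum.
exact: Ud.
Qed.

(** Rescale f and g into the dual balls; A = 0 or C = 0 makes all values vanish and is treated
    apart. *)
Lemma ev_bound w f g A C : linear f -> linear g -> 0 <= A -> 0 <= C ->
  (forall x, nm (f x) <= A * rnorm x) -> (forall y, nm (g y) <= C * rnorm y) ->
  nm (ev w f g) <= A * C * rnorm (elt w).
Proof.
move=> fl gl A0 C0 fA gC.
have [A0'|An0] := eqVneq A 0.
  rewrite /ev big1 ?nm0 ?A0' ?mul0r //.
  move=> p _; have -> : f p.1 = 0; last by rewrite mul0r.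
  by apply: nm_eq0; apply/eqP; rewrite eq_le nm_ge0 andbT; have := fA p.1; rewrite A0' mul0r.
have [C0'|Cn0] := eqVneq C 0.
  rewrite /ev big1 ?nm0 ?C0' ?mulr0 ?mul0r //.
  move=> p _; have -> : g p.2 = 0; last by rewrite mulr0.
  by apply: nm_eq0; apply/eqP; rewrite eq_le nm_ge0 andbT; have := gC p.2; rewrite C0' mul0r.
have Ag : 0 < A by rewrite lt_neqAle eq_sym An0.
have Cg : 0 < C by rewrite lt_neqAle eq_sym Cn0.
have nA : nm (emb k A^-1) = A^-1 by rewrite nm_emb ger0_norm // invr_ge0.
have nC : nm (emb k C^-1) = C^-1 by rewrite nm_emb ger0_norm // invr_ge0.
have Bf : BX (fun x => emb k A^-1 * f x).
  apply/dual_ballP; split; first by move=> a x y; rewrite fl /GRing.scale /=; ring.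
  by move=> x; rewrite nmM nA ler_pdivrMl.
have Bg : BY (fun x => emb k C^-1 * g x).
  apply/dual_ballP; split; first by move=> a x y; rewrite gl /GRing.scale /=; ring.
  by move=> x; rewrite nmM nC ler_pdivrMl.
have := ev_le w Bf Bg.
have -> : ev w (fun x => emb k A^-1 * f x) (fun x => emb k C^-1 * g x) =
    emb k A^-1 * emb k C^-1 * ev w f g.
  by rewrite /ev mulr_sumr; apply: eq_bigr => p _; rewrite mulrACA.
by rewrite !nmM nA nC -invfM ler_pdivrMl ?mulr_gt0.
Qed.

(** Write f (x) g - f' (x) g' as (f - f') (x) g + f' (x) (g - g'). *)
Lemma ev_lipschitz w f f' g g' a b : BX f -> BX f' -> BY g -> BY g' -> 0 <= a -> 0 <= b ->
  (forall x, nm (f x - f' x) <= a * rnorm x) -> (forall y, nm (g y - g' y) <= b * rnorm y) ->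
  nm (ev w f g) <= nm (ev w f' g') + (a + b) * rnorm (elt w).
Proof.
move=> /dual_ballP[fl f1] /dual_ballP[fl' f1'] /dual_ballP[gl g1] /dual_ballP[gl' g1'] a0 b0 fa gb.
have -> : ev w f g = ev w f' g' + (ev w (fun x => f x - f' x) g + ev w f' (fun y => g y - g' y)).
  by rewrite /ev -!big_split /=; apply: eq_bigr => p _; ring.
apply: le_trans (nmD _ _) _; rewrite lerD2l; apply: le_trans (nmD _ _) _.
rewrite mulrDl lerD //.
  rewrite -[a]mulr1; apply: ev_bound => //.
    by move=> c x y; rewrite fl fl' /GRing.scale /=; ring.
  by move=> y; rewrite mul1r.
rewrite -[b]mul1r; apply: ev_bound => //.
  by move=> c x y; rewrite gl gl' /GRing.scale /=; ring.
by move=> y; rewrite mul1r.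
Qed.

Lemma ultra_ev_cvg (I : Type) (U : set_system I) (FU : Filter U)
    (F : I -> X -> K^o) (G : I -> Y -> K^o) f0 g0 w d :
  U [set i | BX (F i)] -> U [set i | BY (G i)] -> BX f0 ->
  (forall xs d, 0 < d -> U [set i | near_on xs d f0 (F i)]) ->
  (forall xs d, 0 < d -> U [set i | near_on xs d g0 (G i)]) ->
  0 < d -> U [set i | nm (ev w (F i) (G i) - ev w f0 g0) < d].
Proof.
move=> UF UG /dual_ballP[_ f01] Uf Ug; elim: w d => [|[x y] w ih] d d0.
  by apply: filterE => i /=; rewrite /ev !big_nil subrr nm0.
have d2 : 0 < d / 2 by lra.
pose c := rnorm x + rnorm y + 1.
have c0 : 0 < c by rewrite ltr_wpDl // addr_ge0 // rnorm_ge0.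
have dc : 0 < d / 2 / c by rewrite divr_gt0.
apply: filterS (filterI UG (filterI (Uf [:: x] _ dc) (filterI (Ug [:: y] _ dc) (ih _ d2)))).
move=> i [/= /dual_ballP[_ g1] [/(_ x (mem_head _ _)) fx [/(_ y (mem_head _ _)) gy ew]]].
rewrite /ev !big_cons /= -/(ev w (F i) (G i)) -/(ev w f0 g0).
have -> : F i x * G i y + ev w (F i) (G i) - (f0 x * g0 y + ev w f0 g0) =
  ((F i x - f0 x) * G i y + f0 x * (G i y - g0 y)) + (ev w (F i) (G i) - ev w f0 g0) by ring.
apply: le_lt_trans (nmD _ _) _.
suff : nm ((F i x - f0 x) * G i y + f0 x * (G i y - g0 y)) <= d / 2 by lra.
apply: le_trans (nmD _ _) _; rewrite !nmM.
have -> : d / 2 = d / 2 / c * rnorm y + rnorm x * (d / 2 / c) + d / 2 / c.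
  by rewrite /c in c0 *; field; rewrite gt_eqF.
rewrite -[leLHS]addr0 lerD ?(ltW dc) // lerD //.
  by rewrite ler_pM ?nm_ge0 ?g1 // ltW.
by rewrite ler_pM ?nm_ge0 ?f01 // ltW.
Qed.

End FormalTensors.

(** * The upper bound *)

Section IteratedFilter.
Variables (I : Type) (V : set_system I).

(** The second index is chosen after the first: q is taken as far along [V] as p requires. *)
Definition iterated_filter : set_system (I * I) :=
  [set A | V [set p | V [set q | A (p, q)]]].

Lemma iterated_filter_proper : ProperFilter V -> ProperFilter iterated_filter.
Proof.
move=> PV; have FV : Filter V by exact: filter_filter.
apply: Build_ProperFilter_ex.
  move=> A; rewrite /iterated_filter /= => /(@filter_ex _ _ PV)[p /=].
  by move=> /(@filter_ex _ _ PV)[q Apq]; exists (p, q).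
split.
- by rewrite /iterated_filter /=; apply: filterE => p; apply: filterE.
- move=> A C VA VC; apply: (@filterS _ V FV _ _ _ (@filterI _ V FV _ _ VA VC)).
  by move=> p [Ap Cp]; apply: (@filterS _ V FV _ _ _ (@filterI _ V FV _ _ Ap Cp)) => q [].
- move=> A C sAC; apply: (@filterS _ V FV) => p; apply: (@filterS _ V FV) => q; exact: sAC.
Qed.

End IteratedFilter.

(** * Witnesses of a derivation and their accumulation *)

Section UpperBound.
Variables (R : realType) (k : scalar_kind).
Local Notation K := (scalar_field R k).
Variables (X Y T : completeNormedModType K) (tau : X -> Y -> T).
Hypothesis T_tensor : is_injective_tensor tau.
Hypothesis X_fin : forall e, 0 < e -> szlenk_fin X e.
Hypothesis Y_fin : forall e, 0 < e -> szlenk_fin Y e.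
Local Notation BX := (@dual_ball R k X).
Local Notation BY := (@dual_ball R k Y).
Local Notation BT := (@dual_ball R k T).
Local Notation elt := (elt tau).

(** One of two points more than e apart is more than e / 2 away from phi; its witness in the unit
    ball is approximated by a formal tensor, of norm at most 2. [V] refines the weak* neighbourhoods
    of phi. *)
Lemma szlenk_deriv_ultra e S phi : 0 < e -> S `<=` BT -> szlenk_deriv e S phi ->
  exists (V : set_system ((T -> K^o) * seq (X * Y))), UltraFilter V /\
  [/\ V [set p | S p.1], V [set p | rnorm (elt p.2) <= 2],
      V [set p | e / 2 < nm (p.1 (elt p.2) - phi (elt p.2))] &
      forall x d, 0 < d -> V [set p | nm (p.1 x - phi x) < d]].
Proof.
move=> e0 SB /szlenk_derivP[Sphi phin].
pose P (p : (T -> K^o) * seq (X * Y)) := [/\ S p.1, rnorm (elt p.2) <= 2 &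
  e / 2 < nm (p.1 (elt p.2) - phi (elt p.2))].
pose V0 : set_system ((T -> K^o) * seq (X * Y)) :=
  filter_from [set q : seq T * R | 0 < q.2] (fun q => [set p | P p /\ near_on q.1 q.2 phi p.1]).
have V0p : ProperFilter V0.
  apply: filter_from_proper; first apply: filter_from_filter.
  - by exists ([::], 1) => /=.
  - move=> [xs d] [ys d'] /= d0 d'0; exists (xs ++ ys, Num.min d d') => /=.
      by rewrite lt_min d0 d'0.
    move=> p /= [Pp pn]; split; split => //; apply: near_on_sub pn; rewrite ?ge_min ?lexx ?orbT //.
      by move=> x; rewrite mem_cat => ->.
    by move=> x; rewrite mem_cat => ->; rewrite orbT.
  - move=> [xs d] /= d0; have [f1 [f2 [S1 S2 n1 n2 [x x1 ex]]]] := phin xs d d0.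
    have [psi [Spsi npsi xpsi]] : exists psi, [/\ S psi, near_on xs d phi psi &
        e / 2 < nm (psi x - phi x)].
      have := nm_triangle (phi x) (f1 x) (f2 x); rewrite (nmB (phi x)) => h.
      have [h1|h1] := ltP (e / 2) (nm (f1 x - phi x)); first by exists f1.
      by exists f2; split=> //; lra.
    have /dual_ballP[phil phi1] := SB _ Sphi; have /dual_ballP[psil psi1] := SB _ Spsi.
    (* As psi - phi has norm at most 2, an approximation error below r costs less than the excess
       over e / 2. *)
    pose r := Num.min 1 ((nm (psi x - phi x) - e / 2) / 2).
    have r0 : 0 < r by rewrite lt_min ltr01 /=; lra.
    have r1 : r <= 1 by rewrite ge_min lexx.
    have r2 : r <= (nm (psi x - phi x) - e / 2) / 2 by rewrite ge_min lexx orbT.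
    have [t tx] := elt_dense T_tensor x r0.
    exists (psi, t); split => //; split => //=.
      have := ler_rnormB (elt t) x; lra.
    have := ler_nmB (psi x - phi x) (psi (elt t) - phi (elt t)).
    have -> : psi x - phi x - (psi (elt t) - phi (elt t)) =
        psi (x - elt t) - phi (x - elt t).
      by rewrite (linear_funB psil) (linear_funB phil); ring.
    have := nmD (psi (x - elt t)) (- phi (x - elt t)); rewrite nmN.
    have := psi1 (x - elt t); have := phi1 (x - elt t); rewrite rnormB; lra.
have [V [FV V0V]] := ultraFilterLemma V0p.
exists V; split => //; split.
- by apply: V0V; exists ([::], 1) => //= p [[]].
- by apply: V0V; exists ([::], 1) => //= p [[]].
- by apply: V0V; exists ([::], 1) => //= p [[]].
- move=> x d d0; apply: V0V; exists ([:: x], d) => //= p [_ pn].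
  by apply: pn; rewrite mem_head.
Qed.

Let half_diff (w w' : seq (X * Y)) := fscale (emb k (2^-1 : R)) w ++ fscale (- emb k (2^-1 : R)) w'.

Let nm_half : nm (emb k (2^-1 : R)) = 2^-1.
Proof. by rewrite nm_emb ger0_norm. Qed.

(* The weakly null t are half differences of two witnesses taken successively along
   the ultrafilter. *)
Lemma szlenk_deriv_weakly_null e S phi : 0 < e -> S `<=` BT -> szlenk_deriv e S phi ->
  exists (I : Type) (W : set_system I) (psi : I -> T -> K^o) (t : I -> seq (X * Y)),
  ProperFilter W /\
  [/\ W [set i | S (psi i)], W [set i | rnorm (elt (t i)) <= 2],
      forall d, 0 < d -> W [set i | e / 4 - d < nm (psi i (elt (t i)))],
      forall (f : X -> K^o) (g : Y -> K^o) d, BX f -> BY g -> 0 < d ->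
        W [set i | nm (ev (t i) f g) < d] &
      forall x d, 0 < d -> W [set i | nm (psi i x - phi x) < d]].
Proof.
move=> e0 SB ephi; have Sphi := szlenk_deriv_sub ephi.
have /dual_ballP[phil phi1] := SB _ Sphi.
have [V [FV [V1 V2 V3 V4]]] := szlenk_deriv_ultra e0 SB ephi.
(* [p.1] carries the first witness, [p.2] the second one together with the functional that is
   kept. *)
exists _, (iterated_filter V), (fun p => p.2.1), (fun p => half_diff p.2.2 p.1.2).
have PV : ProperFilter V by exact: ultra_proper.
have FW := iterated_filter_proper PV; split => //.
have both (P Q : set _) : V P -> V Q ->
    iterated_filter V [set p | P p.1 /\ Q p.2].
  by move=> VP VQ; apply: filterS VP => p Pp /=; apply: filterS VQ => q Qq.
have eltE w w' : elt (half_diff w w') = emb k 2^-1 *: (elt w - elt w').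
  by rewrite /half_diff elt_cat !(elt_scale T_tensor) scaleNr scalerBr.
split.
- apply: filterS (both _ _ filterT V1) => p [_]; exact.
- apply: filterS (both _ _ V2 V2) => p [/= p1 p2].
  rewrite eltE rnormZ nm_half.
  have := rnormD (elt p.2.2) (- elt p.1.2); rewrite rnormN; lra.
- move=> d d0; have d4 : 0 < d / 4 by lra.
  have [|z zP] := @ultra_bounded_cvg R k _ V FV (fun p => phi (elt p.2)) 2.
    by apply: filterS V2 => p /=; apply: le_trans; exact: phi1.
  have Vz := zP _ d4.
  (* The second functional comes after the first witness, hence is close to phi on it. *)
  have VW : iterated_filter V [set p | nm (p.2.1 (elt p.1.2) - phi (elt p.1.2)) < d].
    by rewrite /iterated_filter /=; apply: filterE => p; exact: V4.
  apply: filterS (filterI (both _ _ Vz (filterI V1 (filterI V3 Vz))) VW).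
  move=> p [/= [p1 [S2 [p2 p3]]] p4].
  have /dual_ballP[psil _] := SB _ S2.
  rewrite eltE (linear_funZ psil) nmM nm_half (linear_funB psil).
  (* phi nearly takes the value z at both witnesses, so only the first difference, larger than e /
     2, counts; halving leaves e / 4. *)
  have -> : p.2.1 (elt p.2.2) - p.2.1 (elt p.1.2) =
    (p.2.1 (elt p.2.2) - phi (elt p.2.2)) -
     ((p.2.1 (elt p.1.2) - phi (elt p.1.2)) +
      ((phi (elt p.1.2) - z) - (phi (elt p.2.2) - z))) by ring.
  set a := _ - phi (elt p.2.2) in p2 *; set b := _ - phi (elt p.1.2) in p4 *.
  set c := phi _ - z in p1 *; set c' := phi _ - z in p3 *.
  have := ler_nmB a (b + (c - c')).
  have h1 := nmD b (c - c'); have h2 := nmD c (- c'); rewrite nmN in h2.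
  lra.
- move=> f g d Bf Bg d0.
  have [|z zP] := @ultra_bounded_cvg R k _ V FV (fun p => ev p.2 f g) 2.
    by apply: filterS V2 => p /=; apply: le_trans; exact: ev_le.
  have Vz := zP _ d0.
  apply: filterS (both _ _ Vz Vz) => p [/= p1 p2].
  have /dual_ballP[fl _] := Bf.
  rewrite /half_diff ev_cat !ev_scale //.
  have -> : emb k 2^-1 * ev p.2.2 f g + - emb k 2^-1 * ev p.1.2 f g =
    emb k 2^-1 * ((ev p.2.2 f g - z) - (ev p.1.2 f g - z)) by ring.
  rewrite nmM nm_half.
  have := nmD (ev p.2.2 f g - z) (- (ev p.1.2 f g - z)); rewrite nmN; lra.
- move=> x d d0; have Vx := V4 x d d0.
  by apply: filterS (both _ _ filterT Vx) => p [].
Qed.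

Section Claim.
Variables (e : R) (J : nat).
Hypothesis e_gt0 : 0 < e.
Local Notation h := (potential J).

(** w is the sum of the witnesses collected so far. A derivation adds a weakly null t, worth e / 4
    after a choice of phase. The pair given by induction depends on t, and t is negligible on its
    limit (f0, g0); by [ev_lipschitz] and |t| <= 2 it contributes at most 2 (a + b), which the
    growth of the potentials pays for up to 8 2^-J. *)
Lemma sz_tensor_potential n phi w d : sz e n BT phi -> 0 < d ->
  exists f g, [/\ BX f, BY g & nm (phi (elt w)) + n%:R * (e / 4 - 8 * 2^-1 ^+ J) - d <=
     nm (ev w f g) + 4 * (h f + h g)].
Proof.
elim: n phi w d => [|n ih] phi w d.
  move=> /dual_ballP[_ phi1] d0; have [f [g [Bf Bg fg]]] := ev_adherent T_tensor w d0.
  exists f, g; split => //; rewrite mul0r addr0.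
  have h0 (Z : normedModType K) (f' : Z -> K^o) : 0 <= h f'.
    by apply: sumr_ge0 => j _; rewrite mulr_ge0 // ltW // dyadic_gt0.
  have := h0 _ f; have := h0 _ g; have := phi1 (elt w); lra.
rewrite szS => phie d0.
have SB : sz e n BT `<=` BT by exact: sz_sub.
have [I [W [psi [t [PW [W1 W2 W3 W4 W5]]]]]] := szlenk_deriv_weakly_null e_gt0 SB phie.
(* Five errors of size r occur: three in [G], two when passing to the limit. *)
pose r := d / 5; have r0 : 0 < r by rewrite /r; lra.
pose G i (fg : (X -> K^o) * (Y -> K^o)) := [/\ BX fg.1, BY fg.2 &
  nm (phi (elt w)) + e / 4 + n%:R * (e / 4 - 8 * 2^-1 ^+ J) - 3 * r <=
    nm (ev w fg.1 fg.2) + nm (ev (t i) fg.1 fg.2) + 4 * (h fg.1 + h fg.2)].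
have WG : W [set i | exists fg, G i fg].
  apply: filterS (filterI W1 (filterI (W3 _ r0) (W5 (elt w) _ r0))) => i [/= Spsi [tpsi wpsi]].
  have /dual_ballP[psil _] := SB _ Spsi.
  have [u u1 ua] := nm_align (psi i (elt w)) (psi i (elt (t i))).
  have [f [g [Bf Bg fg]]] := ih (psi i) (w ++ fscale u (t i)) r Spsi r0.
  exists (f, g); split => //=.
  have /dual_ballP[fl _] := Bf.
  move: fg; rewrite ev_cat elt_cat ev_scale // (elt_scale T_tensor).
  rewrite (linear_funD psil) (linear_funZ psil) ua.
  have := nmD (ev w f g) (u * ev (t i) f g); rewrite nmM u1 mul1r.
  have := ler_nmB (phi (elt w)) (phi (elt w) - psi i (elt w)).
  rewrite subKr nmB; rewrite nmB in wpsi; rewrite (nmB (psi i _)).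
  lra.
have /choice[FG FGP] : forall i, exists fg, (exists fg', G i fg') -> G i fg.
  move=> i; have [[fg gP]|ng] := pselect (exists fg', G i fg'); first by exists fg.
  by exists (fun=> 0, fun=> 0).
have [U [FU WU]] := ultraFilterLemma PW.
have UG : U [set i | G i (FG i)].
  by apply: filterS (WU _ WG) => i /= /FGP.
have UF : U [set i | BX (FG i).1] by apply: filterS UG => i [].
have UGy : U [set i | BY (FG i).2] by apply: filterS UG => i [].
have [f0 Uf0] := ultra_ball_cvg FU UF.
have [g0 Ug0] := ultra_ball_cvg FU UGy.
have Bf0 : BX f0 by exact: (ultra_wclosed FU (@dual_ball_wclosed _ _ _) Uf0 UF).
have Bg0 : BY g0 by exact: (ultra_wclosed FU (@dual_ball_wclosed _ _ _) Ug0 UGy).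
exists f0, g0; split => //.
have Ujf := ultra_potential_jump X_fin FU J UF Uf0.
have Ujg := ultra_potential_jump Y_fin FU J UGy Ug0.
have FU' : Filter U by exact: filter_filter.
have Uw := ultra_ev_cvg FU' w UF UGy Bf0 Uf0 Ug0 r0.
have Ut := WU _ (W4 f0 g0 r Bf0 Bg0 r0).
have Ut2 := WU _ W2.
have [i [[/= Bfi Bgi Gi] [jf [jg [wi [ti ti2]]]]]] := filter_ex (filterI UG (filterI Ujf
  (filterI Ujg (filterI Uw (filterI Ut Ut2))))).
have q0 := dyadic_gt0 R J.
have [jf0 {}jf] := jf; have [jg0 {}jg] := jg.
have a0 : 0 <= 2 * (h f0 - h (FG i).1 + 2^-1 ^+ J) by lra.
have b0 : 0 <= 2 * (h g0 - h (FG i).2 + 2^-1 ^+ J) by lra.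
have lip := ev_lipschitz T_tensor (t i) Bfi Bf0 Bgi Bg0 a0 b0 jf jg.
have lip2 := ler_wpM2l (addr_ge0 a0 b0) ti2.
have := ler_nmB (ev w (FG i).1 (FG i).2) (ev w f0 g0).
rewrite -[n.+1%:R]natr1 mulrDl mul1r; rewrite /r in Gi ti wi; lra.
Qed.

End Claim.
End UpperBound.

(** * The lower bound and the conclusion *)

Section DyadicSum.
Variables (R : realType).

(** For N = Sz(X, .) this bounds the potential on the dual ball, where the level at each scale is at
    most N - 1. *)
Definition dyadic_sum (N : R -> nat) (J : nat) : R :=
  \sum_(j < J.+1) 2^-1 ^+ j * (N (2^-1 ^+ j) - 1)%:R.

Lemma dyadic_sum_ge0 N J : 0 <= dyadic_sum N J.
Proof. by apply: sumr_ge0 => j _; rewrite mulr_ge0 // exprn_ge0. Qed.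

(** The terms are at most a constant times q^j with q = 2^(r-1) > 1, so the last one dominates the
    geometric sum. *)
Lemma dyadic_sum_bound (N : R -> nat) (r C : R) : 1 < r -> 0 < C ->
  (forall e, 0 < e < 1 -> (N e)%:R <= C * expR (r * - ln e)) ->
  exists2 D, 0 < D & forall J, dyadic_sum N J <= D * expR ((r - 1) * (J%:R * ln 2)).
Proof.
move=> r1 C0 NC; pose q := expR ((r - 1) * ln 2) : R.
have l2 : 0 < ln 2 :> R by rewrite ln_gt0 // ltr1n.
have q1 : 1 < q by rewrite expR_gt1 mulr_gt0 // subr_gt0.
have C'0 : 0 < C + (N 1)%:R by rewrite ltr_wpDr.
have q10 : 0 < q - 1 by rewrite subr_gt0.
have qJ J : expR ((r - 1) * (J%:R * ln 2)) = q ^+ J.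
  by rewrite mulrCA expRM_natl.
(* N 1 covers the term j = 0, since the assumed bound excludes e = 1. *)
exists ((C + (N 1)%:R) * (q / (q - 1))); first by rewrite mulr_gt0 // divr_gt0 // expR_gt0.
move=> J; rewrite qJ -mulrA.
have term j : 2^-1 ^+ j * (N (2^-1 ^+ j) - 1)%:R <= (C + (N 1)%:R) * q ^+ j.
  apply: le_trans (_ : 2^-1 ^+ j * (N (2^-1 ^+ j))%:R <= _).
    by rewrite ler_wpM2l ?exprn_ge0 // ler_nat leq_subr.
  case: j => [|j]; first by rewrite !expr0 mul1r mulr1 lerDr ltW.
  apply: le_trans (_ : C * q ^+ j.+1 <= _); last first.
    by rewrite ler_wpM2r ?exprn_ge0 ?expR_ge0 // lerDl.
  have e01 : 0 < (2^-1 ^+ j.+1 : R) < 1.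
    by rewrite exprn_gt0 // exprn_ilt1 // invf_lt1 // ltr1n.
  have := ler_wpM2l (ltW (dyadic_gt0 R j.+1)) (NC _ e01).
  suff -> : q ^+ j.+1 = 2^-1 ^+ j.+1 * expR (r * - ln (2^-1 ^+ j.+1)).
    by rewrite mulrCA.
  rewrite -qJ -[X in X * expR _]lnK ?posrE ?dyadic_gt0 // -expRD; congr expR.
  by rewrite lnXn // lnV ?posrE // -mulr_natl; ring.
apply: le_trans (ler_sum _ (fun (j : 'I_J.+1) _ => term j)) _.
rewrite -mulr_sumr ler_wpM2l ?(ltW C'0) // mulrAC -exprS ler_pdivlMr // mulrC.
by rewrite -subrX1 gerBl.
Qed.

End DyadicSum.

Section TensorSymmetry.
Variables (R : realType) (k : scalar_kind).
Local Notation K := (scalar_field R k).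

Lemma is_injective_tensor_sym (X Y T : completeNormedModType K) (tau : X -> Y -> T) :
  is_injective_tensor tau -> is_injective_tensor (fun y x => tau x y).
Proof.
move=> [tl tr tn td]; split => //.
- move=> n y x; rewrite tn; congr ereal_sup.
  apply/seteqP; split=> _ [f Bf [g Bg <-]]; exists g => //; exists f => //;
  by congr ((rnorm _)%:E); apply: eq_bigr => i _; rewrite mulrC.
- move=> O O0 oO; have [t [Ot [n [x [y tE]]]]] := td O O0 oO.
  by exists t; split => //; exists n, y, x.
Qed.

End TensorSymmetry.

(** * Embedding the dual ball of a factor *)

Section LowerBound.
Variables (R : realType) (k : scalar_kind).
Local Notation K := (scalar_field R k).
Variables (X Y T : completeNormedModType K) (tau : X -> Y -> T).
Hypothesis T_tensor : is_injective_tensor tau.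
Local Notation BX := (@dual_ball R k X).
Local Notation BY := (@dual_ball R k Y).
Local Notation BT := (@dual_ball R k T).
Local Notation elt := (elt tau).

Lemma ev_dist w w' (f : X -> K^o) (g : Y -> K^o) : BX f -> BY g ->
  nm (ev w f g - ev w' f g) <= rnorm (elt w - elt w').
Proof.
move=> Bf Bg; have [fl _] := (dual_ballP f).1 Bf.
have := ev_le T_tensor (w ++ fscale (-1) w') Bf Bg.
by rewrite ev_cat ev_scale // elt_cat (elt_scale T_tensor) scaleN1r mulN1r.
Qed.

(** f (x) g is defined at t as an ultrafilter limit of [ev w f g] over formal tensors w tending to
    t. The estimate against every w determines the value and yields linearity. *)
Lemma dual_tensor (f : X -> K^o) (g : Y -> K^o) : BX f -> BY g ->
  exists2 Phi, BT Phi & forall w, Phi (elt w) = ev w f g.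
Proof.
move=> Bf Bg; have [fl _] := (dual_ballP f).1 Bf.
have /choice[Phi PhiP] t : exists z : K^o, forall w, nm (ev w f g - z) <= rnorm (elt w - t).
  pose V0 : set_system (seq (X * Y)) :=
    filter_from [set r : R | 0 < r] (fun r => [set w | rnorm (elt w - t) < r]).
  have V0p : ProperFilter V0.
    apply: filter_from_proper; first apply: filter_from_filter.
    - by exists 1 => /=.
    - move=> r s /= r0 s0; exists (Num.min r s); first by rewrite /= lt_min r0 s0.
      by move=> w; rewrite /= lt_min => /andP[].
    - by move=> r /= r0; exact: elt_dense.
  have [V [FV V0V]] := ultraFilterLemma V0p.
  have Vt r : 0 < r -> V [set w | rnorm (elt w - t) < r].
    by move=> r0; apply: V0V; exists r.
  have [|z zP] := @ultra_bounded_cvg R k _ V FV (fun w => ev w f g) (rnorm t + 1).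
    apply: filterS (Vt _ ltr01) => w /= wt; apply: le_trans (ev_le T_tensor w Bf Bg) _.
    have := ler_rnormB (elt w) t; lra.
  exists z => w; apply/ler_addgt0Pr => d d0; have d2 : 0 < d / 2 by lra.
  have [w' [/= w'z w't]] := filter_ex (filterI (zP _ d2) (Vt _ d2)).
  have := nm_triangle (ev w' f g) (ev w f g) z.
  have := ev_dist w w' Bf Bg; have := rnorm_triangle t (elt w) (elt w').
  rewrite (rnormB t); lra.
exists Phi => [|w]; last first.
  have := PhiP (elt w) w; rewrite subrr rnorm0 => h.
  by apply/esym/eqP; rewrite -subr_eq0; apply/eqP/nm_eq0/eqP; rewrite eq_le h nm_ge0.
apply/dual_ballP; split.
  move=> a s t; apply/eqP; rewrite -subr_eq0; apply/eqP/nm_lt_eq0 => d d0.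
  have c0 : 0 < 2 * nm a + 2 + 1 by have := nm_ge0 a; lra.
  pose r := d / (2 * nm a + 2 + 1); have r0 : 0 < r by rewrite divr_gt0.
  have [w ws] := elt_dense T_tensor s r0; have [w' w't] := elt_dense T_tensor t r0.
  have h1 := PhiP (a *: s + t) (fscale a w ++ w').
  have h2 := PhiP s w; have h3 := PhiP t w'.
  have h4 : rnorm (elt (fscale a w ++ w') - (a *: s + t)) <= nm a * r + r.
    rewrite elt_cat (elt_scale T_tensor) opprD addrACA -scalerBr.
    apply: le_trans (rnormD _ _) _; rewrite rnormZ.
    by rewrite lerD ?ler_wpM2l ?nm_ge0 // ltW.
  have -> : Phi (a *: s + t) - (a *: Phi s + Phi t) =
    - (ev (fscale a w ++ w') f g - Phi (a *: s + t)) +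
     (a * (ev w f g - Phi s) + (ev w' f g - Phi t)).
    by rewrite ev_cat ev_scale // /GRing.scale /=; ring.
  apply: le_lt_trans (nmD _ _) _; rewrite nmN.
  apply: le_lt_trans (lerD (lexx _) (nmD _ _)) _; rewrite nmM.
  have h5 : nm a * nm (ev w f g - Phi s) <= nm a * r.
    by rewrite ler_wpM2l ?nm_ge0 // (le_trans h2) // ltW.
  have h6 : nm a * r + r + (nm a * r + r) + r = d.
    by rewrite /r; field; rewrite gt_eqF.
  lra.
move=> t; apply/ler_addgt0Pr => d d0; have d2 : 0 < d / 2 by lra.
have [w wt] := elt_dense T_tensor t d2; have := PhiP t w.
have := ev_le T_tensor w Bf Bg; have := ler_rnormB (elt w) t.
have := ler_nmB (Phi t) (ev w f g); rewrite nmB; lra.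
Qed.

Lemma ev_near w (f : X -> K^o) (g : Y -> K^o) d : 0 < d -> exists xs d', 0 < d' /\
  forall f', near_on xs d' f f' -> nm (ev w f' g - ev w f g) < d.
Proof.
elim: w d => [|[x y] w ih] d d0.
  by exists [::], 1; split => // f' _; rewrite /ev !big_nil subrr nm0.
have d2 : 0 < d / 2 by lra.
have [xs [d' [d'0 h]]] := ih _ d2.
have c0 : 0 < nm (g y) + 1 by rewrite ltr_wpDl // nm_ge0.
exists (x :: xs), (Num.min d' (d / 2 / (nm (g y) + 1))); split.
  by rewrite lt_min d'0 divr_gt0.
move=> f' fn; rewrite /ev !big_cons /= -/(ev w f' g) -/(ev w f g).
have -> : f' x * g y + ev w f' g - (f x * g y + ev w f g) =
  (f' x - f x) * g y + (ev w f' g - ev w f g) by ring.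
apply: le_lt_trans (nmD _ _) _; rewrite nmM.
have h1 : nm (ev w f' g - ev w f g) < d / 2.
  apply: h; apply: near_on_sub fn; last by rewrite ge_min lexx.
  by move=> z zxs; rewrite inE zxs orbT.
have h2 : nm (f' x - f x) < d / 2 / (nm (g y) + 1).
  by apply: lt_le_trans (fn x (mem_head _ _)) _; rewrite ge_min lexx orbT.
have h3 : nm (f' x - f x) * nm (g y) <= d / 2.
  apply: le_trans (_ : d / 2 / (nm (g y) + 1) * (nm (g y) + 1) <= _).
    by rewrite ler_pM ?nm_ge0 // ?(ltW h2) // lerDl.
  by rewrite divfK // gt_eqF.
lra.
Qed.

(** The map f |-> f (x) g is weak* continuous on the ball and shrinks distances by a factor no
    smaller than |g y| / |y|, as seen on the elements x (x) y / |y|. *)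
Lemma szlenk_nat_factor_le : (exists y : Y, y != 0) ->
  (forall e, 0 < e -> szlenk_fin X e) -> (forall e, 0 < e -> szlenk_fin T e) ->
  exists2 c, 0 < c & forall e, 0 < e -> (szlenk_nat X e <= szlenk_nat T (c * e))%N.
Proof.
move=> [y y0] X_fin T_fin; have [g Bg gy0] := exists_dual_ball_neq0 y0.
have [gl g1] := (dual_ballP g).1 Bg.
have ry := rnorm_gt0 y0.
have gy : 0 < nm (g y).
  by rewrite lt_neqAle nm_ge0 andbT eq_sym; apply: contra_neq gy0 => /nm_eq0.
have /choice[L LP] (f : X -> K^o) : exists Phi : T -> K^o, BX f ->
    BT Phi /\ forall w, Phi (elt w) = ev w f g.
  have [Bf|nBf] := pselect (BX f); last by exists (fun=> 0).
  by have [Phi BPhi PhiP] := dual_tensor Bf Bg; exists Phi.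
have c0 : 0 < nm (g y) / rnorm y by rewrite divr_gt0.
exists (nm (g y) / rnorm y) => // e e0.
apply: szlenk_nat_le_of => //; rewrite -subset0 => f fX.
have ce0 : 0 < nm (g y) / rnorm y * e by rewrite mulr_gt0.
suff : sz (nm (g y) / rnorm y * e) (szlenk_nat T (nm (g y) / rnorm y * e)) BT (L f).
  by rewrite (sz_szlenk_nat T_fin).
apply: (sz_transport (U := setT) _ _ _ _ fX) => //; first exact: wopenT.
- move=> {fX}f Bf zs d d0; elim: zs => [|z zs [xs [d' [d'0 h]]]].
    by exists [::], 1; split => // f' _ _ z; rewrite in_nil.
  (* Two thirds of d go to replacing z by a formal tensor under both functionals, the last to
     continuity on that tensor. *)
  have d3 : 0 < d / 3 by lra.
  have [w wz] := elt_dense T_tensor z d3.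
  have [xs' [d'' [d''0 h']]] := ev_near w f g d3.
  exists (xs ++ xs'), (Num.min d' d''); split; first by rewrite lt_min d'0 d''0.
  move=> f' Bf' fn z'; rewrite inE => /orP[/eqP->{z'}|zzs]; last first.
    apply: (h f') => //; apply: near_on_sub fn; last by rewrite ge_min lexx.
    by move=> x; rewrite mem_cat => ->.
  have [BL LE] := LP f Bf; have [BL' LE'] := LP f' Bf'.
  have := h' f'; rewrite -LE -LE' => a0.
  have {}a0 : nm (L f' (elt w) - L f (elt w)) < d / 3.
    apply: a0; apply: near_on_sub fn; last by rewrite ge_min lexx orbT.
    by move=> x; rewrite mem_cat => ->; rewrite orbT.
  have [Ll L1] := (dual_ballP _).1 BL; have [Ll' L1'] := (dual_ballP _).1 BL'.
  have := L1 (z - elt w); have := L1' (z - elt w).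
  rewrite (linear_funB Ll) (linear_funB Ll') rnormB => a1 a2.
  have -> : L f' z - L f z = (L f' z - L f' (elt w)) +
     ((L f' (elt w) - L f (elt w)) - (L f z - L f (elt w))) by ring.
  apply: le_lt_trans (nmD _ _) _.
  have := nmD (L f' (elt w) - L f (elt w)) (- (L f z - L f (elt w))); rewrite nmN; lra.
- by move=> f' Bf' _; have [] := LP f' Bf'.
- move=> f1 f2 Bf1 Bf2 _ _ [x x1 ex].
  have [BL1 LE1] := LP f1 Bf1; have [BL2 LE2] := LP f2 Bf2.
  pose t := elt [:: (x, emb k (rnorm y)^-1 *: y)].
  have ny : nm (emb k (rnorm y)^-1) = (rnorm y)^-1 by rewrite nm_emb gtr0_norm // invr_gt0.
  exists t.
    apply/ler_addgt0Pr => d d0.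
    have [f' [g' [/dual_ballP[_ f'1] /dual_ballP[_ g'1]]]] :=
      ev_adherent T_tensor [:: (x, emb k (rnorm y)^-1 *: y)] d0.
    rewrite -/t /ev big_cons big_nil addr0 nmM /= => h.
    have h1 : nm (f' x) * nm (g' (emb k (rnorm y)^-1 *: y)) <= 1 * 1.
      rewrite ler_pM ?nm_ge0 //; first exact: le_trans x1.
      by apply: le_trans (g'1 _) _; rewrite rnormZ ny mulVf // gt_eqF.
    lra.
  rewrite LE1 LE2 /ev !big_cons !big_nil !addr0 /= -mulrBl nmM (linear_funZ gl) nmM ny.
  by rewrite mulrC [nm (g y) / _]mulrC ltr_pM2r // mulr_gt0 // invr_gt0.
Qed.

Lemma power_type_factor_le : (exists y : Y, y != 0) ->
  (forall e, 0 < e -> szlenk_fin X e) -> (forall e, 0 < e -> szlenk_fin T e) ->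
  power_type X <= power_type T.
Proof.
move=> Y0 X_fin T_fin; have [c c0 cN] := szlenk_nat_factor_le Y0 X_fin T_fin.
apply/ler_addgt0Pr => d d0; have Td : power_type T < power_type T + d by rewrite ltrDl.
have [C C0 NC] := power_type_bound T_fin Td.
set r := power_type T + d in Td NC *.
have ci : 0 < c^-1 by rewrite invr_gt0.
(* Restricting to e < 1 / c ensures c e < 1; the factor c^(- r) goes into the constant. *)
apply: (power_type_le_of_bound X_fin (C := C * expR (r * - ln c)) ci).
move=> e e0 ec; apply: le_trans (_ : (szlenk_nat T (c * e))%:R <= _).
  by rewrite ler_nat cN.
have ce : 0 < c * e < 1 by rewrite mulr_gt0 //= -ltr_pdivlMl // mulr1.
apply: le_trans (NC _ ce) _.
rewrite -mulrA ler_pM2l // -expRD lnM ?posrE //.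
by rewrite opprD mulrDr.
Qed.

End LowerBound.

(** * Comparison of the power types *)

Section Conclusion.
Variables (R : realType) (k : scalar_kind).
Local Notation K := (scalar_field R k).
Variables (X Y T : completeNormedModType K) (tau : X -> Y -> T).
Hypothesis T_tensor : is_injective_tensor tau.
Hypothesis X_fin : forall e, 0 < e -> szlenk_fin X e.
Hypothesis Y_fin : forall e, 0 < e -> szlenk_fin Y e.
Local Notation BT := (@dual_ball R k T).
Local Notation total J := (dyadic_sum (szlenk_nat X) J + dyadic_sum (szlenk_nat Y) J).

(** The accumulation of witnesses is started from the empty formal tensor. *)
Lemma sz_tensor_le (e : R) J n : 0 < e -> sz e n BT !=set0 ->
  n%:R * (e / 4 - 8 * 2^-1 ^+ J) <= 4 * total J.
Proof.
move=> e0 [phi phin]; apply/ler_addgt0Pr => d d0.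
have [f [g [Bf Bg]]] := sz_tensor_potential T_tensor X_fin Y_fin J e0 [::] phin d0.
have [phil _] := (dual_ballP phi).1 (sz_sub phin).
rewrite /elt /ev !big_nil (linear_fun0 phil) nm0 add0r.
have := potential_le X_fin J Bf; have := potential_le Y_fin J Bg.
rewrite -/(dyadic_sum (szlenk_nat X) J) -/(dyadic_sum (szlenk_nat Y) J); lra.
Qed.

Lemma sz_tensor_le_eighth (e : R) J n : 0 < e -> 2^-1 ^+ J <= e / 64 ->
  sz e n BT !=set0 -> n%:R * (e / 8) <= 4 * total J.
Proof.
move=> e0 Je /(sz_tensor_le J e0); apply: le_trans; rewrite ler_wpM2l //; lra.
Qed.

(** J is one more than the integer part of log2 (1 / e), cut off at 0 for e >= 1; for e < 1 the
    second bound says 2^-J >= e / 2. *)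
Lemma dyadic_between (e : R) : 0 < e -> exists2 J,
  2^-1 ^+ J <= e & e < 1 -> (J%:R * ln 2 <= - ln e + ln 2 :> R).
Proof.
move=> e0; have l2 : 0 < ln 2 :> R by rewrite ln_gt0 // ltr1n.
pose m := Num.max 0 (- ln e / ln 2).
have m0 : 0 <= m by rewrite le_max lexx.
have /andP[m1 m2] := truncn_itv m0.
exists (Num.truncn m).+1 => [|e1].
  rewrite -ler_ln ?posrE ?dyadic_gt0 // lnXn // lnV ?posrE //.
  rewrite -[_ *+ (Num.truncn m).+1]mulr_natl mulrN lerNl.
  rewrite -ler_pdivrMr //; apply: le_trans (ltW m2).
  by rewrite le_max lexx orbT.
have mE : m = - ln e / ln 2.
  by apply: max_idPr; rewrite divr_ge0 // ?(ltW l2) // oppr_ge0 ln_le0 // ltW.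
move: m1; rewrite {2}mE ler_pdivlMr // -[(Num.truncn m).+1%:R]natr1 mulrDl mul1r; lra.
Qed.

Lemma szlenk_fin_tensor e : 0 < e -> szlenk_fin T e.
Proof.
move=> e0; have e64 : 0 < e / 64 by lra.
have [J Je _] := dyadic_between e64.
pose x := 4 * total J / (e / 8).
have x0 : 0 <= x.
  by rewrite divr_ge0 ?mulr_ge0 ?addr_ge0 ?dyadic_sum_ge0 //; lra.
have /andP[_ x2] := truncn_itv x0.
exists (Num.truncn x).+1; apply: contrapT => /eqP/set0P/(sz_tensor_le_eighth e0 Je).
by rewrite leNgt -ltr_pdivrMr ?x2 //; lra.
Qed.

(** N - 1 is the index of the last nonempty derived set. *)
Lemma szlenk_nat_tensor_le e J : 0 < e -> 2^-1 ^+ J <= e / 64 ->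
  (szlenk_nat T e - 1)%:R * (e / 8) <= 4 * total J.
Proof.
move=> e0 Je; apply: sz_tensor_le_eighth => //; apply/set0P/eqP => n0.
have := szlenk_nat_le_of szlenk_fin_tensor e0 n0.
have := szlenk_nat_gt0 szlenk_fin_tensor e0.
by case: (szlenk_nat T e) => // n _; rewrite subSS subn0 ltnn.
Qed.

Lemma power_type_tensor_le : power_type T <= Num.max (power_type X) (power_type Y).
Proof.
have T_fin := szlenk_fin_tensor.
(* Below 1 both indices are identically 1, so the dyadic sums vanish and Sz(T, e) = 1 as well. *)
have [p1|p1] := ltP (Num.max (power_type X) (power_type Y)) 1.
  move: (p1); rewrite gt_max => /andP[pX pY].
  have NX := szlenk_nat_eq1 X_fin pX; have NY := szlenk_nat_eq1 Y_fin pY.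
  rewrite (power_type_eq0 T_fin); first by rewrite le_max power_type_ge0.
  move=> e e0; have e64 : 0 < e / 64 by lra.
  have [J Je _] := dyadic_between e64.
  have := szlenk_nat_tensor_le e0 Je.
  have S0 (N : R -> nat) : (forall e, 0 < e -> N e = 1%N) -> dyadic_sum N J = 0.
    by move=> N1; apply: big1 => j _; rewrite N1 ?dyadic_gt0 // mulr0.
  rewrite !S0 // addr0 mulr0 pmulr_lle0 ?divr_gt0 //.
  rewrite lern0 subn_eq0 => h; apply/eqP; rewrite eqn_leq h.
  exact: szlenk_nat_gt0.
apply/ler_addgt0Pr => d d0.
set r := _ + d; have r1 : 1 < r by rewrite /r; lra.
have [pX pY] : power_type X < r /\ power_type Y < r.
  by split; rewrite (@le_lt_trans _ _ (Num.max (power_type X) (power_type Y))) ?ltrDl //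
    le_max lexx ?orbT.
have [CX CX0 NCX] := power_type_bound X_fin pX.
have [CY CY0 NCY] := power_type_bound Y_fin pY.
have [DX DX0 HX] := dyadic_sum_bound r1 CX0 NCX.
have [DY DY0 HY] := dyadic_sum_bound r1 CY0 NCY.
(* 32 is 4 times 8 from the previous estimate, and ln 64 + ln 2 comes from choosing J for e / 64.
   The + 1 added to E below turns the bound on N - 1 into one on N. *)
pose E := 32 * (DX + DY) * expR ((r - 1) * (ln 64 + ln 2)).
apply: (power_type_le_of_bound T_fin (C := E + 1) ltr01) => e e0 e1.
have e64 : 0 < e / 64 by lra.
have [J Je Jl] := dyadic_between e64.
have {}Jl : J%:R * ln 2 <= ln 64 + ln 2 - ln e.
  have e641 : e / 64 < 1 by lra.
  have := Jl e641; rewrite ln_div ?posrE //; lra.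
have := szlenk_nat_tensor_le e0 Je.
(* The power e^(1 - r) is split as e^(- r) times e, so that e cancels on both sides. *)
have hJ : expR ((r - 1) * (J%:R * ln 2)) <=
    expR ((r - 1) * (ln 64 + ln 2)) * (expR (r * - ln e) * e).
  rewrite -{2}(lnK (x := e)) ?posrE // -!expRD ler_expR.
  have := ler_wpM2l (_ : 0 <= r - 1) Jl; lra.
have := le_trans (HX J) (ler_wpM2l (ltW DX0) hJ).
have := le_trans (HY J) (ler_wpM2l (ltW DY0) hJ).
set S := expR _ * _; move=> h1 h2 h3.
have h4 : (szlenk_nat T e - 1)%:R * e <= E * expR (r * - ln e) * e.
  have -> : E * expR (r * - ln e) * e = 32 * (DX * S + DY * S) by rewrite /E /S; ring.
  lra.
rewrite ler_pM2r // in h4.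
have N0 := szlenk_nat_gt0 T_fin e0.
have one : 1 <= expR (r * - ln e).
  by rewrite -expR0 ler_expR mulr_ge0 ?oppr_ge0 ?ln_le0 ?(ltW e1) //; lra.
rewrite -(subnK N0) natrD mulrDl mul1r; exact: lerD.
Qed.

End Conclusion.

(** Both factors are taken nonzero: a zero factor would make [T] zero, of power type 0, whatever the
    power type of the other factor. *)
Theorem mainTheorem1 (R : realType) (k : scalar_kind)
    (X Y T : completeNormedModType (scalar_field R k)) (tau : X -> Y -> T)
    (X_neq0 : exists x : X, x != 0) (Y_neq0 : exists y : Y, y != 0)
    (X_szlenk : szlenk_le X omega) (Y_szlenk : szlenk_le Y omega)
    (T_tensor : is_injective_tensor tau) :
  szlenk_le T omega /\
  power_type T = Num.max (power_type X) (power_type Y).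
Proof.
have X_fin := szlenk_le_omega_fin X_szlenk; have Y_fin := szlenk_le_omega_fin Y_szlenk.
have T_fin := szlenk_fin_tensor T_tensor X_fin Y_fin.
split; first exact: szlenk_fin_le_omega.
apply/eqP; rewrite eq_le (power_type_tensor_le T_tensor X_fin Y_fin) ge_max.
rewrite (power_type_factor_le T_tensor) //=.
exact: (power_type_factor_le (is_injective_tensor_sym T_tensor)).
Qed.
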